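(* Let $(\mathbf{X}_t)_{t\ge 1}$ be the sequence produced by Algorithm 1 (described in the context) applied to $\min_{\mathbf{X}\in\mathcal{S}^n} f(\mathbf{X})$, where $f$ is convex and $\beta$-smooth over $\mathcal{S}^n$ with respect to the norm pair $\Vert\cdot\Vert,\Vert\cdot\Vert_*$, and denote $h_t:=f(\mathbf{X}_t)-f^*$. (i) For every $t\ge 2$, $$h_t\le \frac{8\beta D^2}{t+7}.$$ (ii) Suppose in addition that the following two assumptions hold. Quadratic growth: there is a scalar $\alpha>0$ such that $\min_{\mathbf{X}^*\in\mathcal{X}^*}\Vert\mathbf{X}-\mathbf{X}^*\Vert^2\le\frac{2}{\alpha}\left(f(\mathbf{X})-f^*\right)$ for every $\mathbf{X}\in\mathcal{S}^n$. Common rank of optimal solutions: there is an integer $r^*\in\{1,\ldots,n\}$ such that $\mathrm{rank}(\mathbf{X}^* )=r^*$ for all $\mathbf{X}^*\in\mathcal{X}^*$. Let $\lambda_{r^*}^*:=\min_{\mathbf{X}^*\in\mathcal{X}^*}\lambda_{r^*}(\mathbf{X}^* )$ and define $$\rho:=\min\left\{\frac12,\ \frac{(\sqrt2-1)\,\alpha\,\lambda_{r^*}^*}{2560\, r^*\kappa_{r^*}^2\left(\frac{\beta D^2}{2}+\widetilde G\right)}\right\}.$$ Then on every iteration $t$ which is not a drop iteration, $$h_{t+1}\le(1-\rho)h_t,$$ and for every $t\ge 1$, $$h_t\le h_1(1-\rho)^{\lceil (t-1)/2\rceil}.$$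
   Context: **Problem setting.** $\mathbb{S}^n$ is the space of real symmetric $n\times n$ matrices and $\mathcal{S}^n:=\{\mathbf{X}\in\mathbb{S}^n : \mathbf{X}\succeq 0,\ \mathrm{Tr}(\mathbf{X})=1\}$. Eigenvalues of $\mathbf{A}\in\mathbb{S}^n$ are ordered $\lambda_1(\mathbf{A})\ge\cdots\ge\lambda_n(\mathbf{A})$; $\langle\mathbf{A},\mathbf{B}\rangle:=\mathrm{Tr}(\mathbf{A}\mathbf{B})$; $\mathbf{A}^\dagger$ is the Moore–Penrose pseudoinverse; $\mathrm{Im}$ denotes column space. $\Vert\cdot\Vert$ is an arbitrary fixed unitarily invariant matrix norm and $\Vert\cdot\Vert_*$ is its dual norm with respect to the trace inner product; $\Vert\cdot\Vert_2$ is the Euclidean norm of vectors and spectral norm of matrices; $\Vert\cdot\Vert_F$ is the Frobenius norm. The function $f$ is convex and $\beta$-smooth over $\mathcal{S}^n$: $\Vert\nabla f(\mathbf{X})-\nabla f(\mathbf{Y})\Vert_*\le\beta\Vert\mathbf{X}-\mathbf{Y}\Vert$ for all $\mathbf{X},\mathbf{Y}\in\mathcal{S}^n$. $\mathcal{X}^*:=\mathrm{argmin}_{\mathbf{X}\in\mathcal{S}^n}f(\mathbf{X})$ and $f^*$ is the optimal value. Define $$\widetilde G:=\sup_{\mathbf{X}\in\mathcal{S}^n}\Vert\nabla f(\mathbf{X})-\lambda_n(\nabla f(\mathbf{X}))\mathbf{I}\Vert_2,\quad D:=\sup_{\mathbf{X},\mathbf{Y}\in\mathcal{S}^n}\Vert\mathbf{X}-\mathbf{Y}\Vert,\quad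 \kappa_{r^*}:=\sup_{\mathbf{A}\in\mathbb{S}^n,\ \mathbf{A}\ne\mathbf{0},\ \mathrm{rank}(\mathbf{A})\le 2r^*}\frac{\Vert\mathbf{A}\Vert_F}{\Vert\mathbf{A}\Vert}.$$ **Algorithm 1.** Start with $\mathbf{X}_1=\mathbf{x}_1\mathbf{x}_1^\top$ for an arbitrary unit vector $\mathbf{x}_1\in\mathbb{R}^n$. On iteration $t=1,2,\ldots$: 1. Let $\nabla_t:=\nabla f(\mathbf{X}_t)$, let $\mathbf{v}_{t,+}$ be a unit eigenvector of $\nabla_t$ for its smallest eigenvalue $\lambda_n(\nabla_t)$, and let $\widetilde\nabla_t:=\nabla_t-\lambda_n(\nabla_t)\mathbf{I}\succeq 0$. Choose (ties broken arbitrarily) $$\mathbf{v}_{t,-}\in\mathop{\mathrm{argmax}}_{\mathbf{v}\in\mathrm{Im}(\mathbf{X}_t),\ \Vert\mathbf{v}\Vert_2=1}\mathbf{v}^\top\widetilde\nabla_t\mathbf{v},\qquad \mathbf{u}_t\in\mathop{\mathrm{argmax}}_{\mathbf{u}\in\mathrm{Im}(\mathbf{X}_t),\ \Vert\mathbf{u}\Vert_2=1}\frac{\mathbf{u}^\top\widetilde\nabla_t^2\mathbf{u}}{\mathbf{u}^\top\mathbf{X}_t^\dagger\mathbf{u}}.$$ 2. Set $a_t:=\langle\widetilde\nabla_t,\mathbf{X}_t\rangle^2$, $b_t:=(\mathbf{v}_{t,-}^\top\widetilde\nabla_t\mathbf{v}_{t,-}-\langle\widetilde\nabla_t,\mathbf{X}_t\rangle)^2$,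 $c_t:=\frac{\mathbf{u}_t^\top\widetilde\nabla_t^2\mathbf{u}_t-(\mathbf{u}_t^\top\widetilde\nabla_t\mathbf{u}_t)^2}{\mathbf{u}_t^\top\mathbf{X}_t^\dagger\mathbf{u}_t}$. If $\max\{a_t,b_t,c_t\}=0$, terminate. 3. For $\theta\in[0,1]$ define three paths and coefficients: - Frank-Wolfe: $\Phi_t^{\rm FW}(\theta):=\mathbf{X}_t+\theta(\mathbf{v}_{t,+}\mathbf{v}_{t,+}^\top-\mathbf{X}_t)$, $\delta_t^{\rm FW}:=\frac12\langle\widetilde\nabla_t,\mathbf{X}_t\rangle$. - Away: with $s_t:=(\mathbf{v}_{t,-}^\top\mathbf{X}_t^\dagger\mathbf{v}_{t,-}-1)^{-1}$, $\Phi_t^{\rm A}(\theta):=\mathbf{X}_t+\theta s_t(\mathbf{X}_t-\mathbf{v}_{t,-}\mathbf{v}_{t,-}^\top)$, $\delta_t^{\rm A}:=\frac12 s_t(\mathbf{v}_{t,-}^\top\widetilde\nabla_t\mathbf{v}_{t,-}-\langle\widetilde\nabla_t,\mathbf{X}_t\rangle)$. - Pairwise: with $\gamma_t:=(\mathbf{u}_t^\top\mathbf{X}_t^\dagger\mathbf{u}_t)^{-1}$, $\mathbf{p}_t:=\frac{(\mathbf{I}-\mathbf{u}_t\mathbf{u}_t^\top)\widetilde\nabla_t\mathbf{u}_t}{\Vert(\mathbf{I}-\mathbf{u}_t\mathbf{u}_t^\top)\widetilde\nabla_t\mathbf{u}_t\Vert_2}$, $\mathbf{v}_t(\theta):=\frac{\mathbf{u}_t-\theta\mathbf{p}_t}{\sqrt{1+\theta^2}}$,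 $\Phi_t^{\rm P}(\theta):=\mathbf{X}_t+\gamma_t(\mathbf{v}_t(\theta)\mathbf{v}_t(\theta)^\top-\mathbf{u}_t\mathbf{u}_t^\top)$, $\delta_t^{\rm P}:=\gamma_t\Vert(\mathbf{I}-\mathbf{u}_t\mathbf{u}_t^\top)\widetilde\nabla_t\mathbf{u}_t\Vert_2$. 4. Armijo search: with $\Theta:=\{0\}\cup\{2^{-j}:j=0,1,\ldots\}$, for each $i\in\{{\rm FW},{\rm A},{\rm P}\}$ let $\theta_t^i$ be the largest $\theta\in\Theta$ with $f(\Phi_t^i(\theta))\le f(\mathbf{X}_t)-\theta\delta_t^i$, and $\mathbf{X}_t^i:=\Phi_t^i(\theta_t^i)$. Degenerate cases: if $\mathrm{rank}(\mathbf{X}_t)=1$ or $\delta_t^{\rm A}=0$, set $\Phi_t^{\rm A}\equiv\mathbf{X}_t$, $\delta_t^{\rm A}=0$, $\theta_t^{\rm A}=0$, $\mathbf{X}_t^{\rm A}=\mathbf{X}_t$. If $(\mathbf{I}-\mathbf{u}_t\mathbf{u}_t^\top)\widetilde\nabla_t\mathbf{u}_t=\mathbf{0}$, set $\Phi_t^{\rm P}\equiv\mathbf{X}_t$, $\delta_t^{\rm P}=0$ (so $\mathbf{X}_t^{\rm P}=\mathbf{X}_t$). 5. If $\theta_t^{\rm A}=1$, set $\mathbf{X}_{t+1}:=\mathbf{X}_t^{\rm A}$; such an iteration is called a *drop iteration*. Otherwise set $\mathbf{X}_{t+1}$ to be a point of $\{\mathbf{X}_t^{\rm FW},\mathbf{X}_t^{\rm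 A},\mathbf{X}_t^{\rm P}\}$ with smallest objective value (a non-drop iteration). If the algorithm terminates at some iteration $T$, the produced sequence is $\mathbf{X}_1,\ldots,\mathbf{X}_T$, and the claims concern the indices $t$ for which the iterates involved are defined. *)

(* Defs.v *)
From mathcomp Require Import all_boot all_order all_algebra.
From mathcomp Require Import all_classical all_reals all_analysis.

Set Implicit Arguments.
Unset Strict Implicit.
Unset Printing Implicit Defensive.

Import Order.TTheory GRing.Theory Num.Theory numFieldNormedType.Exports.

Local Open Scope classical_set_scope.
Local Open Scope ring_scope.

Section Optimum.
Variables (R : realType) (T : Type).

Definition argmax (A : set T) (g : T -> R) : set T :=
  [set x | A x /\ forall y, A y -> g y <= g x].

Definition argmin (A : set T) (g : T -> R) : set T :=
  [set x | A x /\ forall y, A y -> g x <= g y].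

End Optimum.

Section Matrices.
Variables (R : realType) (n : nat).
Implicit Types (A B X Y : 'M[R]_n) (u v : 'cV[R]_n).

Definition inner A B : R := \tr (A *m B).

Definition qform A v : R := (v^T *m A *m v) 0 0.

Definition norm2 v : R := Num.sqrt (\sum_i v i 0 ^+ 2).

Definition frobenius A : R := Num.sqrt (\sum_i \sum_j A i j ^+ 2).

Definition spectral_norm A : R := sup [set norm2 (A *m v) | v in [set v | norm2 v = 1]].

Definition psd A : Prop := A^T = A /\ forall v, 0 <= qform A v.

Definition spectrahedron : set 'M[R]_n := [set X | psd X /\ \tr X = 1].

(* The nonincreasing list of eigenvalues, with multiplicity. It is the junk
   value [::] only if the characteristic polynomial does not split over R, which
   never happens for a symmetric matrix. *)
Definition eigvals A : seq R :=
  xget [::] [set s | sorted >=%O s /\ char_poly A = \prod_(x <- s) ('X - x%:P)].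

(* Indices start at 1: eigval 1 A is the largest and eigval n A the smallest. *)
Definition eigval (k : nat) A : R := nth 0 (eigvals A) k.-1.

(* Moore-Penrose inverse, which exists and is unique over the reals (MathComp's
   pinvmx is a partial inverse but not this one). *)
Definition is_mp_inverse A B : Prop :=
  [/\ A *m B *m A = A, B *m A *m B = B, (A *m B)^T = A *m B & (B *m A)^T = B *m A].

Definition mp_inverse A : 'M[R]_n := xget 0 [set B | is_mp_inverse A B].

(* Unit vectors of the column space of A. *)
Definition unit_image A : set 'cV[R]_n :=
  [set v | (v^T <= A^T)%MS /\ norm2 v = 1].

Record unitarily_invariant_norm (N : 'M[R]_n -> R) : Prop := {
  uin_triangle : forall A B, N (A + B) <= N A + N B;
  uin_scale : forall (c : R) A, N (c *: A) = `|c| * N A;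
  uin_definite : forall A, N A = 0 -> A = 0;
  uin_invariant : forall U V A,
    U *m U^T = 1%:M -> V *m V^T = 1%:M -> N (U *m A *m V) = N A }.

(* Dual norm of the space of symmetric matrices. For symmetric A the supremum
   over all B with N B <= 1 would be the same, by unitary invariance. *)
Definition dual_norm (N : 'M[R]_n -> R) A : R :=
  sup [set inner A B | B in [set B | B^T = B /\ N B <= 1]].

(* G is the gradient at X of the restriction of f to the space of symmetric
   matrices, for the trace inner product: the values of f at matrices that are
   not symmetric play no role. *)
Definition is_gradient (f : 'M[R]_n -> R) X (G : 'M[R]_n) : Prop :=
  let F := within [set Y : 'M[R]_n | Y^T = Y] (nbhs X) in
  G^T = G /\ (fun Y => f Y - f X - inner G (Y - X)) =o_F (fun Y => Y - X).

Definition smooth (N : 'M[R]_n -> R) (beta : R) (grad : 'M[R]_n -> 'M[R]_n) : Prop :=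
  forall X Y, spectrahedron X -> spectrahedron Y ->
    dual_norm N (grad X - grad Y) <= beta * N (X - Y).

Definition optimizers (f : 'M[R]_n -> R) : set 'M[R]_n := argmin spectrahedron f.

Definition optval (f : 'M[R]_n -> R) : R := inf [set f X | X in spectrahedron].

Definition diameter (N : 'M[R]_n -> R) : R :=
  sup [set N (X - Y) | X in spectrahedron & Y in spectrahedron].

Definition shifted_grad (G : 'M[R]_n) : 'M[R]_n := G - (eigval n G)%:M.

Definition Gtilde (grad : 'M[R]_n -> 'M[R]_n) : R :=
  sup [set spectral_norm (shifted_grad (grad X)) | X in spectrahedron].

Definition kappa (N : 'M[R]_n -> R) (r : nat) : R :=
  sup [set frobenius A / N A |
       A in [set A | [/\ A^T = A, A != 0 & (\rank A <= 2 * r)%N]]].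

(* Both infima below are attained, the set of optimizers being compact and
   nonempty: they are minima. *)
Definition quadratic_growth (N : 'M[R]_n -> R) (f : 'M[R]_n -> R) (alpha : R) : Prop :=
  forall X, spectrahedron X ->
    inf [set N (X - Y) ^+ 2 | Y in optimizers f] <= 2 / alpha * (f X - optval f).

Definition min_opt_eigval (f : 'M[R]_n -> R) (r : nat) : R :=
  inf [set eigval r Y | Y in optimizers f].

End Matrices.

(* fw_dir is v_{t,+}, away_dir is v_{t,-} and pair_dir is u_t. *)
Record directions (R : realType) (n : nat) := Directions {
  fw_dir : 'cV[R]_n;
  away_dir : 'cV[R]_n;
  pair_dir : 'cV[R]_n }.

Section Iteration.
Variables (R : realType) (n : nat) (f : 'M[R]_n -> R).
(* X is the current iterate, G the gradient of f at X. *)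
Variables (X G : 'M[R]_n) (d : directions R n).

Let Gs := shifted_grad G.
Let Xp := mp_inverse X.
Let vp := fw_dir d.
Let vm := away_dir d.
Let u := pair_dir d.

Definition valid_directions : Prop :=
  [/\ norm2 vp = 1 /\ G *m vp = eigval n G *: vp,
      argmax (unit_image X) (qform Gs) vm
    & argmax (unit_image X) (fun w => qform (Gs *m Gs) w / qform Xp w) u].

Definition coef_a : R := inner Gs X ^+ 2.
Definition coef_b : R := (qform Gs vm - inner Gs X) ^+ 2.
Definition coef_c : R := (qform (Gs *m Gs) u - qform Gs u ^+ 2) / qform Xp u.

Definition stops : Prop := Num.max coef_a (Num.max coef_b coef_c) = 0.

Definition step_sizes : set R := [set th | th = 0 \/ exists j : nat, th = 2 ^- j].

(* The largest admissible step size; it exists when path 0 = X. *)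
Definition armijo (path : R -> 'M[R]_n) (delta : R) : R :=
  let A := [set th | step_sizes th /\ f (path th) <= f X - th * delta] in
  xget 0 (A `&` ubound A).

Definition fw_path (th : R) : 'M[R]_n := X + th *: (vp *m vp^T - X).
Definition fw_delta : R := 2^-1 * inner Gs X.
Definition fw_point : 'M[R]_n := fw_path (armijo fw_path fw_delta).

Definition away_scale : R := (qform Xp vm - 1)^-1.
Definition away_slope : R := 2^-1 * away_scale * (qform Gs vm - inner Gs X).
Definition away_degenerate : bool := (\rank X == 1%N) || (away_slope == 0).

Definition away_path (th : R) : 'M[R]_n :=
  if away_degenerate then X else X + (th * away_scale) *: (X - vm *m vm^T).
Definition away_delta : R := if away_degenerate then 0 else away_slope.
Definition away_theta : R :=
  if away_degenerate then 0 else armijo away_path away_delta.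
Definition away_point : 'M[R]_n := away_path away_theta.

Definition pair_residual : 'cV[R]_n := (1%:M - u *m u^T) *m Gs *m u.
Definition pair_weight : R := (qform Xp u)^-1.
Definition pair_p : 'cV[R]_n := (norm2 pair_residual)^-1 *: pair_residual.
Definition pair_v (th : R) : 'cV[R]_n :=
  (Num.sqrt (1 + th ^+ 2))^-1 *: (u - th *: pair_p).

Definition pair_path (th : R) : 'M[R]_n :=
  if pair_residual == 0 then X
  else X + pair_weight *: (pair_v th *m (pair_v th)^T - u *m u^T).
Definition pair_delta : R :=
  if pair_residual == 0 then 0 else pair_weight * norm2 pair_residual.
Definition pair_point : 'M[R]_n := pair_path (armijo pair_path pair_delta).

Definition is_drop : bool := away_theta == 1.

Definition is_next (X' : 'M[R]_n) : Prop :=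
  if is_drop then X' = away_point
  else argmin [set fw_point; away_point; pair_point] f X'.

End Iteration.

(* A run terminates at iteration t (Some t) or never (None). *)
Definition reached (stop : option nat) (t : nat) : bool :=
  if stop is Some t0 then (t <= t0)%N else true.

(* Iterations are numbered from 1: X 0, d 0 and the values beyond the
   terminating iteration are unconstrained. *)
Record algorithm_run (R : realType) (n : nat) (f : 'M[R]_n -> R)
    (grad : 'M[R]_n -> 'M[R]_n) (stop : option nat)
    (X : nat -> 'M[R]_n) (d : nat -> directions R n) : Prop := {
  run_init : exists2 x : 'cV[R]_n, norm2 x = 1 & X 1%N = x *m x^T;
  run_directions : forall t : nat, (1 <= t)%N -> reached stop t ->
    valid_directions (X t) (grad (X t)) (d t);
  run_stop : forall t : nat, stop = Some t ->
    (1 <= t)%N /\ stops (X t) (grad (X t)) (d t);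
  run_next : forall t : nat, (1 <= t)%N -> reached stop t.+1 ->
    ~ stops (X t) (grad (X t)) (d t) /\
    is_next f (X t) (grad (X t)) (d t) (X t.+1) }.

(* Main.v *)
Require Import Defs.
From mathcomp Require Import all_boot all_order all_algebra.
From mathcomp Require Import all_classical all_reals all_analysis.
From mathcomp Require Import perm complex ring lra zify.

Set Implicit Arguments.
Unset Strict Implicit.
Unset Printing Implicit Defensive.

Import Order.TTheory GRing.Theory Num.Theory numFieldNormedType.Exports.

Local Open Scope classical_set_scope.
Local Open Scope ring_scope.

(** Notation for the explanations: at an iterate X, let Gs be the shifted
    gradient, g = <Gs, X>, M = beta D^2, and let h be the gap between f X and the
    optimal value. Since Gs is positive semidefinite, convexity gives h <= g.

    Sublinear rate. Backtracking on the quadratic upper bound of f ([descent])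
    makes a Frank-Wolfe step gain g / 2 or g^2 / (4 M) ([fw_progress]). With
    h <= g this is the usual recurrence, solved by 4 M / (k + 4) after k non-drop
    iterations ([sublinear_step]). A drop iteration lowers the rank of the iterate
    and any other raises it by at most one, so that, starting from rank one, at
    least half of the iterations are non-drop ([run_count]).

    Linear rate. On a non-drop iteration the coefficients a, b and c are all at
    most e^2 = 8 (M / 2 + Gtilde) times the decrease of f ([nondrop_coefs]). Small
    a and b make the form of Gs at most 2 e on the range of X; a small c then
    makes |Gs w|^2 at most 5 e^2 w^T X^+ w there, which says that Gs X^(1/2) has
    spectral norm at most sqrt 5 e ([away_form_le], [pair_form_le]).

    Let Z be an optimizer close to X. Factor Z = V V^T, where V has r columns and
    V^T X V is diagonal ([adapted_factor]), and let U U^T = X V (V^T X V)^+ V^T X be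
    the Nystrom approximation of X along V. It has three virtues. The remainder
    X - U U^T is positive semidefinite and supported on the range of X, so that
    its product with Gs is at most 2 e times its trace ([tail_le]). The columns of
    U have pseudoinverse norm at most one, so that |Gs U| is at most e times sqrt (5 r)
    ([GU_le]). And U^T V is positive semidefinite, which means that U and V are
    already optimally aligned: |U - V| is controlled by |U U^T - V V^T| over
    the square root of the r-th eigenvalue of Z ([procrustes], the source of the
    constant sqrt 2 - 1). The last distance is at most that of X and Z compressed
    to a subspace of dimension 2 r, hence at most kappa N (X - Z)
    ([factor_distance]).

    Altogether h <= <Gs, X - Z> is at most a multiple of e kappa N (X - Z)
    ([inner_gap]), while quadratic growth makes N (X - Z)^2 at most a multiple of
    h. Squaring, one factor h cancels, and what remains says that the decrease is
    at least a fixed fraction of h ([nondrop_contraction]). *)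

(** * The trace form *)

Section TraceForm.
Variable R : realType.

(** The dot product of columns, and the Frobenius product of square matrices.
    Having it on [n] by [r] matrices treats [r] columns at once. *)
Definition dotm m n (A B : 'M[R]_(m, n)) : R := \tr (A^T *m B).

Section Basics.
Variables m n : nat.
Implicit Types A B C : 'M[R]_(m, n).

Lemma dotmE A B : dotm A B = \sum_j \sum_i A i j * B i j.
Proof.
rewrite /dotm /mxtrace; apply: eq_bigr => j _; rewrite mxE.
by apply: eq_bigr => i _; rewrite mxE.
Qed.

Lemma dotmC A B : dotm A B = dotm B A.
Proof. by rewrite /dotm -mxtrace_tr trmx_mul trmxK. Qed.

Lemma dotmDl A B C : dotm (A + B) C = dotm A C + dotm B C.
Proof. by rewrite /dotm linearD /= mulmxDl mxtraceD. Qed.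

Lemma dotmDr A B C : dotm C (A + B) = dotm C A + dotm C B.
Proof. by rewrite /dotm mulmxDr mxtraceD. Qed.

Lemma dotmZl (c : R) A B : dotm (c *: A) B = c * dotm A B.
Proof. by rewrite /dotm linearZ /= -scalemxAl mxtraceZ. Qed.

Lemma dotmZr (c : R) A B : dotm A (c *: B) = c * dotm A B.
Proof. by rewrite dotmC dotmZl dotmC. Qed.

Lemma dotmNl A B : dotm (- A) B = - dotm A B.
Proof. by rewrite -scaleN1r dotmZl mulN1r. Qed.

Lemma dotmNr A B : dotm A (- B) = - dotm A B.
Proof. by rewrite dotmC dotmNl dotmC. Qed.

Lemma dotmBl A B C : dotm (A - B) C = dotm A C - dotm B C.
Proof. by rewrite dotmDl dotmNl. Qed.

Lemma dotmBr A B C : dotm C (A - B) = dotm C A - dotm C B.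
Proof. by rewrite dotmDr dotmNr. Qed.

Lemma dotm_ge0 A : 0 <= dotm A A.
Proof.
rewrite dotmE; apply: sumr_ge0 => j _; apply: sumr_ge0 => i _.
by rewrite -expr2 sqr_ge0.
Qed.

Lemma dotm_eq0 A : dotm A A = 0 -> A = 0.
Proof.
rewrite dotmE => /eqP; rewrite psumr_eq0; last first.
  by move=> j _; apply: sumr_ge0 => i _; rewrite -expr2 sqr_ge0.
move=> /allP A0; apply/matrixP => i j; rewrite mxE.
have := A0 j (mem_index_enum _); rewrite psumr_eq0; last first.
  by move=> k _; rewrite -expr2 sqr_ge0.
by move=> /allP /(_ i (mem_index_enum _)); rewrite -expr2 sqrf_eq0 => /eqP.
Qed.

Lemma dotm0l A : dotm 0 A = 0.
Proof. by rewrite /dotm trmx0 mul0mx mxtrace0. Qed.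

Lemma dotm0r A : dotm A 0 = 0.
Proof. by rewrite dotmC dotm0l. Qed.

Lemma dotm_sqrD A B :
  dotm (A + B) (A + B) = dotm A A + 2 * dotm A B + dotm B B.
Proof. by rewrite dotmDl !dotmDr (dotmC B A); ring. Qed.

Lemma dotm_gt0 A : A != 0 -> 0 < dotm A A.
Proof.
move=> A0; rewrite lt_neqAle dotm_ge0 andbT eq_sym.
by apply: contra_neq A0 => /dotm_eq0.
Qed.

Lemma unit_multiple A : A != 0 ->
  exists2 c : R, 0 < c & dotm (c *: A) (c *: A) = 1.
Proof.
move=> /dotm_gt0 A0; exists (Num.sqrt (dotm A A))^-1.
  by rewrite invr_gt0 sqrtr_gt0.
rewrite dotmZl dotmZr mulrA -invfM -expr2 sqr_sqrtr ?(ltW A0) //.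
by rewrite mulVf // gt_eqF.
Qed.

End Basics.

Lemma dotm_tr m n (A B : 'M[R]_(m, n)) : dotm A^T B^T = dotm A B.
Proof. by rewrite /dotm trmxK mxtrace_mulC; exact: dotmC. Qed.

Lemma dotm_mull m n p (A : 'M[R]_(m, p)) (B : 'M[R]_(m, n)) (C : 'M[R]_(n, p)) :
  dotm A (B *m C) = dotm (B^T *m A) C.
Proof. by rewrite /dotm trmx_mul trmxK mulmxA. Qed.

Lemma dotm_mulr m n p (A : 'M[R]_(m, p)) (B : 'M[R]_(m, n)) (C : 'M[R]_(n, p)) :
  dotm A (B *m C) = dotm (A *m C^T) B.
Proof. by rewrite /dotm mulmxA mxtrace_mulC trmx_mul trmxK mulmxA. Qed.

Lemma dotm_outer m n (A : 'M[R]_(m, n)) : dotm A A = \tr (A *m A^T).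
Proof. by rewrite mxtrace_mulC. Qed.

Lemma dotm_gram m n (A B : 'M[R]_(m, n)) :
  dotm (A *m A^T) (B *m B^T) = dotm (A^T *m B) (A^T *m B).
Proof. by rewrite dotm_mulr trmxK -mulmxA dotmC dotm_mull. Qed.

Lemma trmx_mul_dot n (u v : 'cV[R]_n) : u^T *m v = (dotm u v)%:M.
Proof. by rewrite [LHS]mx11_scalar /dotm /mxtrace big_ord1. Qed.

Lemma unit_dim_gt0 n (v : 'cV[R]_n) : dotm v v = 1 -> (0 < n)%N.
Proof.
case: n v => // v; rewrite dotmE big_ord1 big_ord0 => /eqP.
by rewrite eq_sym oner_eq0.
Qed.

Lemma discriminant_le (a b c : R) : 0 <= c ->
  (forall t, 0 <= a + 2 * t * b + t ^+ 2 * c) -> b ^+ 2 <= a * c.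
Proof.
move=> c0 h; have [cz|cn] := eqVneq c 0.
  (* An affine function of t that is bounded below is constant. *)
  have [->|bn] := eqVneq b 0; first by rewrite cz mulr0 expr0n.
  have := h (- (a + 1) / (2 * b)).
  rewrite cz mulr0 addr0 (_ : 2 * _ * b = - (a + 1)); first by lra.
  by field.
have cp : 0 < c by rewrite lt_neqAle eq_sym cn.
have := h (- b / c).
rewrite (_ : _ + _ = (a * c - b ^+ 2) / c); last by field.
by rewrite pmulr_lge0 ?invr_gt0 // subr_ge0.
Qed.

Lemma dotm_CS m n (A B : 'M[R]_(m, n)) : dotm A B ^+ 2 <= dotm A A * dotm B B.
Proof.
apply: discriminant_le; first exact: dotm_ge0.
move=> t; have := dotm_ge0 (A + t *: B).
rewrite !dotmDl !dotmDr !dotmZl !dotmZr (dotmC B A); lra.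
Qed.

End TraceForm.

(** * Spectral theorem for real symmetric matrices *)

Section Spectral.
Variable R : realType.

Local Notation C := (R[i]).

(** A complex eigenvector x + i y has a real eigenvalue, by symmetry, and then
    x and y are eigenvectors for it as well. *)
Lemma symmetric_eigenvector n (A : 'M[R]_n.+1) : A^T = A ->
  exists (a : R) (v : 'cV[R]_n.+1), v != 0 /\ A *m v = a *: v.
Proof.
move=> As.
pose inj := real_complex R.
have [|a /eigenvalueP[w wA w0]] := @eigenvalue_closed C _ (map_mx inj A) => //.
pose x := map_mx (@complex.Re R) w; pose y := map_mx (@complex.Im R) w.
have eR : x *m A = complex.Re a *: x - complex.Im a *: y.
  apply/rowP => j; have /(congr1 (@complex.Re R)) := congr1 (fun M : 'rV_ _ => M 0 j) wA.
  rewrite !mxE raddf_sum /=; case: (a) => ar ai.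
  rewrite (_ : complex.Re (_ * _) = ar * complex.Re (w 0 j) - ai * complex.Im (w 0 j));
    last by case: (w 0 j).
  move=> <-; apply: eq_bigr => k _; rewrite !mxE.
  by case: (w 0 k) => p q /=; rewrite mulr0 subr0.
have eI : y *m A = complex.Im a *: x + complex.Re a *: y.
  apply/rowP => j; have /(congr1 (@complex.Im R)) := congr1 (fun M : 'rV_ _ => M 0 j) wA.
  rewrite !mxE raddf_sum /=; case: (a) => ar ai.
  rewrite (_ : complex.Im (_ * _) = ai * complex.Re (w 0 j) + ar * complex.Im (w 0 j)); last first.
    by case: (w 0 j) => p q /=; rewrite addrC.
  move=> <-; apply: eq_bigr => k _; rewrite !mxE.
  by case: (w 0 k) => p q /=; rewrite mulr0 add0r.
have xy0 : (x != 0) || (y != 0).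
  apply: contraNT w0; rewrite negb_or !negbK => /andP[/eqP x0 /eqP y0].
  apply/eqP/rowP => j.
  have := congr1 (fun M : 'rV_ _ => M 0 j) x0; have := congr1 (fun M : 'rV_ _ => M 0 j) y0.
  by rewrite !mxE; case: (w 0 j) => p q /= -> ->.
have i0 : complex.Im a = 0.
  have sw : dotm (x *m A) y = dotm (y *m A) x.
    by rewrite dotmC dotm_mulr As.
  move: sw; rewrite eR eI dotmBl dotmDl !dotmZl (dotmC y x) => sw.
  have : complex.Im a * (dotm x x + dotm y y) = 0 by lra.
  move/eqP; rewrite mulf_eq0 => /orP[/eqP//|].
  rewrite paddr_eq0 ?dotm_ge0 // => /andP[/eqP/dotm_eq0 x0 /eqP/dotm_eq0 y0].
  by move: xy0; rewrite x0 y0 eqxx.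
move: eR eI; rewrite i0 !scale0r subr0 add0r => eR eI.
exists (complex.Re a); case/orP: xy0 => z0; [exists x^T|exists y^T]; split.
- by rewrite -trmx0 (inj_eq trmx_inj).
- by rewrite -{1}As -trmx_mul eR linearZ.
- by rewrite -trmx0 (inj_eq trmx_inj).
- by rewrite -{1}As -trmx_mul eI linearZ.
Qed.

(** The reflection that exchanges [v] and the first basis vector. *)
Lemma householder n (v : 'cV[R]_n.+1) : dotm v v = 1 ->
  exists Q : 'M[R]_n.+1, [/\ Q^T = Q, Q *m Q = 1%:M & Q *m delta_mx 0 0 = v].
Proof.
move=> v1; pose e : 'cV[R]_n.+1 := delta_mx 0 0; pose w := v - e.
have e1 : dotm e e = 1 by rewrite /dotm trmx_delta mul_delta_mx /mxtrace big_ord1 !mxE eqxx.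
have [w0|wn] := eqVneq w 0.
  exists 1%:M; split; rewrite ?trmx1 ?mul1mx //.
  by apply/esym/eqP; rewrite -subr_eq0 -/e -/w w0.
have ww0 : dotm w w != 0 by apply: contra_neq wn => /dotm_eq0.
have ww : dotm w w = - 2 * dotm w e.
  rewrite /w !dotmBl !dotmBr v1 e1 (dotmC e v); ring.
exists (1%:M - (2 / dotm w w) *: (w *m w^T)); split.
- by rewrite linearB /= linearZ /= trmx1 trmx_mul trmxK.
- rewrite mulmxBl !mulmxBr mulmx1 mul1mx mulmx1 -!scalemxAl -!scalemxAr.
  rewrite mulmxA -(mulmxA w) trmx_mul_dot mul_mx_scalar -scalemxAl !scalerA.
  rewrite (_ : _ * _ * _ = 2 / dotm w w + 2 / dotm w w); last by field.
  by rewrite scalerDl opprB addrK subrK.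
- rewrite -/e mulmxBl mul1mx -scalemxAl -mulmxA trmx_mul_dot mul_mx_scalar scalerA.
  rewrite (_ : _ * _ = -1); last first.
    by rewrite ww; field; move: ww0; rewrite ww mulf_eq0 negb_or => /andP[].
  by rewrite scaleN1r opprK /w addrC subrK.
Qed.

(** Conjugating by the reflection that sends the first basis vector to a unit
    eigenvector splits off a block of size one. *)
Lemma symmetric_diagonalizable n (A : 'M[R]_n) : A^T = A ->
  exists (O : 'M[R]_n) (d : 'rV[R]_n), O^T *m O = 1%:M /\ A = O *m diag_mx d *m O^T.
Proof.
elim: n A => [A _|n IH A As].
  by exists 1%:M, 0; split; apply/matrixP => i; case: (i).
have [a [v0 [/unit_multiple[c c0 v1] Av0]]] := symmetric_eigenvector As.
set v := c *: v0 in v1.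
have Av : A *m v = a *: v by rewrite -scalemxAr Av0 !scalerA mulrC.
have [Q [Qs QQ Qe]] := householder v1.
pose B : 'M[R]_(1 + n) := Q *m A *m Q.
have Bs : B^T = B by rewrite !trmx_mul Qs As mulmxA.
have Be : B *m delta_mx 0 0 = a *: (delta_mx 0 0 : 'cV[R]_n.+1).
  by rewrite -!mulmxA Qe Av -scalemxAr -Qe mulmxA QQ mul1mx.
have Bcol : forall i, B i 0 = a * (i == 0)%:R.
  move=> i; have := congr1 (fun M : 'cV_ _ => M i 0) Be.
  by rewrite -colE !mxE andbT.
have AB : A = Q *m B *m Q by rewrite /B !mulmxA QQ mul1mx -mulmxA QQ mulmx1.
clearbody B.
have Bblk : B = block_mx a%:M 0 0 (drsubmx B).
  rewrite -{1}(submxK B); congr block_mx; apply/matrixP => i j.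
  - by rewrite !mxE !ord1 lshift0 Bcol eqxx mulr1 mulr1n.
  - rewrite -{1}Bs !mxE ord1 lshift0 Bcol.
    by rewrite (_ : (rshift 1 j == 0) = false) // mulr0.
  - rewrite !mxE ord1 lshift0 Bcol.
    by rewrite (_ : (rshift 1 i == 0) = false) // mulr0.
have [|O2 [d2 [orthO2 Bd]]] := IH (drsubmx B).
  by rewrite trmx_drsub Bs.
pose P : 'M[R]_(1 + n) := block_mx 1%:M 0 0 O2.
have PT : P^T = block_mx 1%:M 0 0 O2^T by rewrite /P tr_block_mx trmx1 !trmx0.
have PP : P^T *m P = 1%:M.
  rewrite PT mulmx_block !mulmx0 !mul0mx mulmx1 !addr0 add0r orthO2.
  by rewrite -scalar_mx_block.
have PDP : P *m diag_mx (row_mx a%:M d2) *m P^T = B.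
  rewrite PT Bblk diag_mx_row !mulmx_block.
  rewrite !mulmx0 !mul0mx !mulmx1 !mul1mx !addr0 !add0r mul0mx Bd.
  by congr block_mx; apply/matrixP => i j; rewrite !mxE !ord1.
exists (Q *m P), (row_mx a%:M d2); split.
  by rewrite trmx_mul Qs mulmxA -(mulmxA _ Q Q) QQ mulmx1 PP.
by rewrite AB -PDP trmx_mul Qs !mulmxA.
Qed.

End Spectral.

Section SortedSpectral.
Variables (R : realType) (n : nat).
Implicit Types (A B : 'M[R]_n).

Lemma char_poly_orth_conj A (U : 'M[R]_n) : U^T *m U = 1%:M ->
  char_poly (U *m A *m U^T) = char_poly A.
Proof.
move=> UU; have UU2 := mulmx1C UU.
pose UX := map_mx polyC U.
have UX1 : UX *m UX^T = 1%:M by rewrite /UX matrix.map_trmx -map_mxM UU2 map_mx1.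
have -> : char_poly (U *m A *m U^T) = \det (UX *m char_poly_mx A *m UX^T).
  rewrite /char_poly /char_poly_mx; congr (\det _).
  rewrite mulmxBr mulmxBl scalar_mxC -(mulmxA _ UX) UX1 mulmx1; congr (_ - _).
  by rewrite !map_mxM /UX matrix.map_trmx.
by rewrite !det_mulmx mulrAC -det_mulmx UX1 det1 mul1r.
Qed.

Lemma eigvals_uniq A (s : seq R) : sorted >=%O s ->
  char_poly A = \prod_(x <- s) ('X - x%:P) -> eigvals A = s.
Proof.
move=> ss sA; apply: xget_subset1; first by split.
move=> s1 s2 [s1s e1] [s2s e2]; apply: (sorted_eq ge_trans) s1s s2s _.
  by move=> x y; rewrite andbC => /le_anti.
by apply: prod_XsubC_eq; rewrite -e1 -e2.
Qed.

Lemma eigvals_sort (U : 'M[R]_n) (d : 'rV[R]_n) : U^T *m U = 1%:M ->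
  eigvals (U *m diag_mx d *m U^T) = sort >=%O [tuple d 0 i | i < n].
Proof.
move=> UU; apply: eigvals_uniq; first by apply: sort_sorted; exact: ge_total.
rewrite char_poly_orth_conj // char_poly_trig ?diag_mx_is_trig //.
transitivity (\prod_(x <- [tuple d 0 i | i < n]) ('X - x%:P)).
  by rewrite big_tuple; apply: eq_bigr => i _; rewrite tnth_mktuple !mxE eqxx.
by apply: perm_big; rewrite perm_sym perm_sort.
Qed.

(** Permuting the columns of any orthogonal diagonalization lists its diagonal
    in the order of [eigvals]. *)
Lemma spectral_eigval A : A^T = A ->
  exists2 U : 'M[R]_n, U^T *m U = 1%:M &
    A = U *m diag_mx (\row_i eigval i.+1 A) *m U^T.
Proof.
move=> As; have [U0 [d [UU Ad]]] := symmetric_diagonalizable As.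
pose t := [tuple d 0 i | i < n]; pose s := sort >=%O t.
have st : perm_eq s t by rewrite perm_sort.
have sE : eigvals A = s by rewrite Ad eigvals_sort.
have [p sp] := tuple_permP st.
have ep (i : 'I_n) : eigval i.+1 A = d 0 (p i).
  by rewrite /eigval sE sp -tnth_nth tnth_mktuple [LHS](_ : _ = tnth t (p i)) ?tnth_mktuple.
exists (col_perm p U0).
  apply/matrixP => i j; have := congr1 (fun M : 'M[R]_n => M (p i) (p j)) UU.
  rewrite !mxE (inj_eq perm_inj) => <-.
  by apply: eq_bigr => k _; rewrite !mxE.
rewrite [LHS]Ad; apply/matrixP => i j.
rewrite !mul_mx_diag !mxE (reindex_inj (@perm_inj _ p)).
by apply: eq_bigr => k _; rewrite !mxE ep.
Qed.

Lemma eigval_le A (i j : nat) : A^T = A -> (0 < i <= j)%N -> (j <= n)%N ->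
  eigval j A <= eigval i A.
Proof.
move=> As /andP[i0 ij] jn; have [U [d [UU Ad]]] := symmetric_diagonalizable As.
pose s := sort >=%O [tuple d 0 i | i < n].
have sE : eigvals A = s by rewrite Ad eigvals_sort.
have ss : sorted >=%O s by apply: sort_sorted; exact: ge_total.
have sz : size s = n by rewrite size_sort size_tuple.
rewrite /eigval sE; apply: (sorted_leq_nth ge_trans ge_refl 0 ss).
- by rewrite inE sz; case: i i0 ij => // i _ ij; apply: leq_trans ij jn.
- by rewrite inE sz prednK // (leq_trans i0 ij).
- by case: i j i0 ij {jn} => // i [].
Qed.

End SortedSpectral.

(** * Quadratic forms and positive semidefinite matrices *)

Section Forms.
Variables (R : realType) (n : nat).
Implicit Types (A B G W X : 'M[R]_n) (u v w z : 'cV[R]_n).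

Lemma qformE A v : qform A v = dotm v (A *m v).
Proof. by rewrite /qform -mulmxA trmx_mul_dot mxE eqxx. Qed.

Lemma qform_scale A (c : R) w :
  qform A (c *: w) = c ^+ 2 * qform A w.
Proof. by rewrite !qformE -scalemxAr dotmZl dotmZr expr2 mulrA. Qed.

Lemma innerE A B : inner A B = dotm A^T B.
Proof. by rewrite /dotm trmxK. Qed.

Lemma innerBr A B G : inner A (B - G) = inner A B - inner A G.
Proof. by rewrite !innerE dotmBr. Qed.

Lemma innerBl A B G : inner (B - G) A = inner B A - inner G A.
Proof. by rewrite !innerE linearB /= dotmBl. Qed.

Lemma innerDr A B G : inner A (B + G) = inner A B + inner A G.
Proof. by rewrite !innerE dotmDr. Qed.

Lemma innerZr (c : R) A B : inner A (c *: B) = c * inner A B.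
Proof. by rewrite !innerE dotmZr. Qed.

Lemma inner_scalar (c : R) A : inner c%:M A = c * \tr A.
Proof. by rewrite /inner mul_scalar_mx mxtraceZ. Qed.

Lemma norm2E v : norm2 v = Num.sqrt (dotm v v).
Proof.
by rewrite dotmE big_ord1; congr Num.sqrt; apply: eq_bigr => i _; rewrite expr2.
Qed.

Lemma norm2_ge0 v : 0 <= norm2 v.
Proof. exact: sqrtr_ge0. Qed.

Lemma norm2_sqr v : norm2 v ^+ 2 = dotm v v.
Proof. by rewrite norm2E sqr_sqrtr // dotm_ge0. Qed.

Lemma norm2_eq1 v : norm2 v = 1 -> dotm v v = 1.
Proof. by move=> v1; rewrite -norm2_sqr v1 expr1n. Qed.

Lemma norm2_dot1 v : dotm v v = 1 -> norm2 v = 1.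
Proof. by move=> v1; rewrite norm2E v1 sqrtr1. Qed.

Lemma frobeniusE A : frobenius A = Num.sqrt (dotm A A).
Proof.
rewrite dotmE exchange_big /=; congr Num.sqrt.
Qed.

Lemma frobenius_sqr A : frobenius A ^+ 2 = dotm A A.
Proof. by rewrite frobeniusE sqr_sqrtr // dotm_ge0. Qed.

(** Cauchy-Schwarz between [A] and the rank-one matrix A v v^T. *)
Lemma dotm_mulvv A v : dotm (A *m v) (A *m v) <= dotm A A * dotm v v.
Proof.
set y := A *m v.
have e : dotm y y = dotm A (y *m v^T) by rewrite dotm_mulr trmxK.
have e2 : dotm (y *m v^T) (y *m v^T) = dotm y y * dotm v v.
  by rewrite dotm_mulr trmxK -mulmxA trmx_mul_dot mul_mx_scalar dotmZl mulrC.
have := dotm_CS A (y *m v^T); rewrite -e e2 mulrCA expr2.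
have := dotm_ge0 y; rewrite le_eqVlt => /orP[/eqP <- _|y0].
  by rewrite mulr_ge0 ?dotm_ge0.
by rewrite ler_pM2l.
Qed.

Lemma frobenius_ge0 A : 0 <= frobenius A.
Proof. exact: sqrtr_ge0. Qed.

Lemma entry_le_frobenius A i j : `|A i j| <= frobenius A.
Proof.
rewrite -sqrtr_sqr; apply: ler_wsqrtr.
rewrite (bigD1 i) //= (bigD1 j) //= -addrA lerDl addr_ge0 // ?sumr_ge0 // => *.
  exact: sqr_ge0.
by apply: sumr_ge0 => *; exact: sqr_ge0.
Qed.

Lemma inner_CS A B : A^T = A -> `|inner A B| <= frobenius A * frobenius B.
Proof.
move=> As; rewrite innerE As -sqrtr_sqr !frobeniusE -sqrtrM ?dotm_ge0 //.
by apply: ler_wsqrtr; exact: dotm_CS.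
Qed.

Lemma norm2_mul_le A v : norm2 v = 1 -> norm2 (A *m v) <= frobenius A.
Proof.
move=> /norm2_eq1 v1; rewrite norm2E frobeniusE; apply: ler_wsqrtr.
by apply: le_trans (dotm_mulvv _ _) _; rewrite v1 mulr1.
Qed.

Lemma dotm_cols k (C : 'M[R]_(n, k)) A :
  dotm C (A *m C) = \sum_j qform A (col j C).
Proof.
rewrite /dotm /mxtrace; apply: eq_bigr => j _.
rewrite /qform !colE mulmxA.
transitivity (((delta_mx 0 j : 'rV[R]_k) *m (C^T *m A *m C) *m (delta_mx j 0 : 'cV[R]_k)) 0 0).
  by rewrite -rowE -colE !mxE.
by rewrite trmx_mul trmx_delta !mulmxA.
Qed.

Lemma dotm_cols1 k (C : 'M[R]_(n, k)) :
  dotm C C = \sum_j dotm (col j C) (col j C).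
Proof.
rewrite -[X in dotm _ X]mul1mx dotm_cols; apply: eq_bigr => j _.
by rewrite qformE mul1mx.
Qed.

Lemma qform_lower_dotm W (c : R) k (C : 'M[R]_(n, k)) :
  (forall z, c * dotm z z <= qform W z) ->
  c * dotm C C <= dotm C (W *m C).
Proof.
move=> Wc; rewrite dotm_cols dotm_cols1 mulr_sumr; apply: ler_sum => j _.
exact: Wc.
Qed.

Lemma psd_dotm_ge0 k A (C : 'M[R]_(n, k)) : psd A -> 0 <= dotm C (A *m C).
Proof. by case=> _ A0; rewrite dotm_cols sumr_ge0. Qed.

Lemma psd_CS k A (C D : 'M[R]_(n, k)) : psd A ->
  dotm C (A *m D) ^+ 2 <= dotm C (A *m C) * dotm D (A *m D).
Proof.
move=> Apsd; have [As _] := Apsd; apply: discriminant_le; first exact: psd_dotm_ge0.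
move=> t; have := psd_dotm_ge0 (C + t *: D) Apsd.
rewrite mulmxDr !dotmDl !dotmDr -scalemxAr !dotmZl !dotmZr.
by rewrite (dotm_mull D) As (dotmC (A *m D) C); lra.
Qed.

Lemma psd_gram k (C : 'M[R]_(n, k)) : psd (C *m C^T).
Proof.
split; first by rewrite trmx_mul trmxK.
move=> v; rewrite qformE -mulmxA dotm_mull; exact: dotm_ge0.
Qed.

Lemma psdD A B : psd A -> psd B -> psd (A + B).
Proof.
move=> [As A0] [Bs B0]; split; first by rewrite linearD /= As Bs.
by move=> v; rewrite qformE mulmxDl dotmDr -!qformE addr_ge0.
Qed.

Lemma psdZ (c : R) A : 0 <= c -> psd A -> psd (c *: A).
Proof.
move=> c0 [As A0]; split; first by rewrite linearZ /= As.
by move=> v; rewrite qformE -scalemxAl dotmZr -qformE mulr_ge0.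
Qed.

Lemma psd_conj k A (Q : 'M[R]_(n, k)) : psd A -> psd (Q^T *m A *m Q).
Proof.
move=> Apsd; have [As A0] := Apsd; split.
  by rewrite !trmx_mul trmxK As mulmxA.
move=> v; rewrite (_ : qform _ v = qform A (Q *m v)) //.
by rewrite /qform trmx_mul !mulmxA.
Qed.

Lemma spectral_col A (U : 'M[R]_n) (d : 'rV[R]_n) i : U^T *m U = 1%:M ->
  A = U *m diag_mx d *m U^T ->
  dotm (col i U) (col i U) = 1 /\ A *m col i U = d 0 i *: col i U.
Proof.
move=> UU ->; rewrite !colE; split.
  rewrite dotm_mull mulmxA UU mul1mx /dotm trmx_delta mul_delta_mx.
  by rewrite /mxtrace big_ord1 !mxE eqxx.
rewrite -!mulmxA (mulmxA U^T) UU mul1mx scalemxAr; congr (_ *m _).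
by apply/matrixP => k l; rewrite mul_diag_mx !mxE; case: eqP => [->|]; rewrite ?mulr0.
Qed.

(** The factor has the form A K so that its columns lie in the range of [A]. *)
Lemma psd_factor A : psd A ->
  exists K : 'M[R]_n, A = (A *m K) *m (A *m K)^T.
Proof.
move=> [As A0]; have [U [d [UU AE]]] := symmetric_diagonalizable As.
have d0 i : 0 <= d 0 i.
  have [c1 Ac] := spectral_col i UU AE.
  by have := A0 (col i U); rewrite qformE Ac dotmZr c1 mulr1.
exists (U *m diag_mx (\row_i (Num.sqrt (d 0 i))^-1)).
have -> : A *m (U *m diag_mx (\row_i (Num.sqrt (d 0 i))^-1)) =
          U *m diag_mx (\row_i Num.sqrt (d 0 i)).
  rewrite {1}AE -!mulmxA (mulmxA U^T) UU mul1mx mulmx_diag; congr (_ *m diag_mx _).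
  apply/rowP => i; rewrite !mxE.
  have [->|dn] := eqVneq (d 0 i) 0; first by rewrite sqrtr0 mul0r.
  by rewrite -{1}(sqr_sqrtr (d0 i)) expr2 mulfK // sqrtr_eq0 -ltNge lt_neqAle eq_sym dn d0.
rewrite trmx_mul tr_diag_mx -!mulmxA (mulmxA (diag_mx _)) mulmx_diag {1}AE -mulmxA; congr (_ *m (diag_mx _ *m _)).
by apply/rowP => i; rewrite !mxE -expr2 sqr_sqrtr.
Qed.

(** Invert the eigenvalues; the convention 0^-1 = 0 is right for the kernel. *)
Lemma mp_inverse_spec A : A^T = A -> is_mp_inverse A (mp_inverse A).
Proof.
move=> As; have [U [d [UU AE]]] := symmetric_diagonalizable As.
pose E := \row_i (d 0 i)^-1.
have conjM (a b : 'rV[R]_n) :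
    (U *m diag_mx a *m U^T) *m (U *m diag_mx b *m U^T) =
    U *m diag_mx (\row_i (a 0 i * b 0 i)) *m U^T.
  by rewrite -!mulmxA (mulmxA U^T U) UU mul1mx (mulmxA (diag_mx a)) mulmx_diag.
have conjT (a : 'rV[R]_n) : (U *m diag_mx a *m U^T)^T = U *m diag_mx a *m U^T.
  by rewrite !trmx_mul trmxK tr_diag_mx mulmxA.
apply: (@xgetPex _ 0 [set B | is_mp_inverse A B]).
exists (U *m diag_mx E *m U^T); rewrite AE; split; rewrite !conjM ?conjT //.
- congr (_ *m diag_mx _ *m _); apply/rowP => i; rewrite !mxE.
  by have [->|dn] := eqVneq (d 0 i) 0; rewrite ?mulr0 // divff // mul1r.
- congr (_ *m diag_mx _ *m _); apply/rowP => i; rewrite !mxE.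
  by have [->|dn] := eqVneq (d 0 i) 0; rewrite ?invr0 ?mulr0 // mulVf // mul1r.
Qed.

Lemma eigval_ge0 A (i : nat) : psd A -> (0 < i <= n)%N -> 0 <= eigval i A.
Proof.
move=> [As A0] /andP[i0 ni]; have [U UU AE] := spectral_eigval As.
have i1n : (i.-1 < n)%N by rewrite prednK.
have [c1 Ac] := spectral_col (Ordinal i1n) UU AE.
have := A0 (col (Ordinal i1n) U).
by rewrite qformE Ac dotmZr c1 mulr1 mxE /= prednK.
Qed.

Lemma min_eigvector A : A^T = A -> (0 < n)%N ->
  exists2 v : 'cV[R]_n, dotm v v = 1 & A *m v = eigval n A *: v.
Proof.
move=> As n0; have [U UU AE] := spectral_eigval As.
have i1n : (n.-1 < n)%N by rewrite prednK.
have [c1 Ac] := spectral_col (Ordinal i1n) UU AE.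
by exists (col (Ordinal i1n) U) => //; rewrite Ac mxE /= prednK.
Qed.

Lemma psd_diag_conj (U : 'M[R]_n) (d : 'rV[R]_n) :
  (forall i, 0 <= d 0 i) -> psd (U *m diag_mx d *m U^T).
Proof.
move=> d0; rewrite (_ : _ *m _ = (U *m diag_mx (\row_i Num.sqrt (d 0 i))) *m
    (U *m diag_mx (\row_i Num.sqrt (d 0 i)))^T); first exact: psd_gram.
rewrite trmx_mul tr_diag_mx -!mulmxA (mulmxA (diag_mx _)) mulmx_diag; congr (_ *m (diag_mx _ *m _)).
by apply/rowP => i; rewrite !mxE -expr2 sqr_sqrtr.
Qed.

Lemma psd_shifted_grad G : G^T = G -> psd (shifted_grad G).
Proof.
move=> Gs; have [U UU GE] := spectral_eigval Gs; have UU2 := mulmx1C UU.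
rewrite /shifted_grad (_ : _ - _ =
    U *m diag_mx (\row_i (eigval i.+1 G - eigval n G)) *m U^T).
  apply: psd_diag_conj => i; rewrite mxE subr_ge0.
  by apply: eigval_le => //=; exact: ltn_ord.
have cE : (eigval n G)%:M = U *m (eigval n G)%:M *m U^T.
  by rewrite scalar_mxC -mulmxA UU2 mulmx1.
rewrite {1}GE cE -mulmxBl -mulmxBr.
congr (_ *m _ *m _); apply/matrixP => i j; rewrite !mxE.
by case: eqP => // _; rewrite ?subr0 // !mulr0n subrr.
Qed.

(** [E] is a sum of outer products of vectors of its range, hence of the range
    of [X]. *)
Lemma inner_psd_le G E X L : psd E -> (E^T <= X^T)%MS ->
  (forall w, qform G (X *m w) <= L * dotm (X *m w) (X *m w)) ->
  inner G E <= L * \tr E.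
Proof.
move=> Epsd EX GL; have [K EK] := psd_factor Epsd.
have [F EF] := submxP EX.
have EXF : E = X *m F^T by rewrite -[E]trmxK EF trmx_mul trmxK.
set C := E *m K in EK.
have CX j : col j C = X *m col j (F^T *m K).
  by rewrite /C {1}EXF !colE !mulmxA.
have -> : \tr E = dotm C C by rewrite EK mxtrace_mulC.
have -> : inner G E = dotm C (G *m C).
  by rewrite EK /inner mulmxA mxtrace_mulC.
rewrite dotm_cols dotm_cols1 mulr_sumr; apply: ler_sum => j _.
by rewrite CX.
Qed.

Lemma inner_psd_ge0 A B : psd A -> psd B -> 0 <= inner A B.
Proof.
move=> Ap Bp; have [K ->] := psd_factor Bp.
rewrite /inner mulmxA mxtrace_mulC; exact: psd_dotm_ge0.
Qed.

Lemma inner_outer A v : inner A (v *m v^T) = qform A v.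
Proof. by rewrite /inner mulmxA mxtrace_mulC qformE. Qed.

Lemma psd_qform_le_tr A v : psd A -> qform A v <= \tr A * dotm v v.
Proof.
move=> Ap; have [K AK] := psd_factor Ap; set C := A *m K in AK.
rewrite qformE {1}AK -mulmxA dotm_mull.
apply: le_trans (dotm_mulvv _ _) _; rewrite dotm_tr.
by rewrite {1}AK mxtrace_mulC.
Qed.

End Forms.

(** * The spectrahedron *)

Section Spectrahedron.
Variables (R : realType) (n : nat).
Implicit Types (A B G X Y : 'M[R]_n) (u v w z : 'cV[R]_n).

Lemma psd_tr0 A : psd A -> \tr A = 0 -> A = 0.
Proof.
move=> Ap; have [K AK] := psd_factor Ap.
rewrite {1}AK mxtrace_mulC => /dotm_eq0 K0.
by rewrite AK K0 mul0mx.
Qed.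

Lemma spectrahedron_sym X : spectrahedron X -> X^T = X.
Proof. by case=> -[]. Qed.

Lemma spectrahedron_outer v : dotm v v = 1 -> spectrahedron (v *m v^T).
Proof. by move=> v1; split; [exact: psd_gram | rewrite -dotm_outer]. Qed.

Lemma spectrahedron_conv X Y (t : R) : 0 <= t <= 1 ->
  spectrahedron X -> spectrahedron Y -> spectrahedron (X + t *: (Y - X)).
Proof.
move=> /andP[t0 t1] [Xp X1] [Yp Y1].
have -> : X + t *: (Y - X) = (1 - t) *: X + t *: Y.
  by apply/matrixP => i j; rewrite !mxE; ring.
split; first by apply: psdD; apply: psdZ; rewrite ?subr_ge0.
by rewrite mxtraceD !mxtraceZ X1 Y1 !mulr1 subrK.
Qed.

(** Vectors of the range of [X] are written X w throughout: this turns the form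
    of the pseudoinverse into the form of [X] itself. *)
Lemma qform_mp X w : X^T = X -> qform (mp_inverse X) (X *m w) = qform X w.
Proof.
move=> Xs; have [XX _ _ _] := mp_inverse_spec Xs.
rewrite /qform trmx_mul Xs.
by rewrite -{4}XX !mulmxA.
Qed.

Lemma image_vec X v : X^T = X -> (v^T <= X^T)%MS -> exists w, v = X *m w.
Proof.
move=> Xs /submxP[D vD]; exists D^T.
by rewrite -[v]trmxK vD trmx_mul trmxK.
Qed.

Lemma unit_imageP X v : X^T = X -> unit_image X v ->
  dotm v v = 1 /\ exists w, v = X *m w.
Proof. by move=> Xs [iv /norm2_eq1 v1]; split=> //; exact: image_vec. Qed.

(** Cauchy-Schwarz for the form of [X], read on its range through the
    pseudoinverse. *)
Lemma mp_CS X z w : psd X ->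
  dotm z (X *m w) ^+ 2 <= qform X z * qform (mp_inverse X) (X *m w).
Proof.
by move=> Xp; rewrite qform_mp ?(proj1 Xp) // !qformE; exact: psd_CS.
Qed.

Lemma mp_ge1 X v : spectrahedron X -> unit_image X v ->
  1 <= qform (mp_inverse X) v.
Proof.
move=> [Xp X1] /(unit_imageP (proj1 Xp))[v1 [w vw]].
have := mp_CS v w Xp; rewrite -vw v1 expr1n.
have := psd_qform_le_tr v Xp; rewrite X1 v1 mulr1.
have : 0 <= qform (mp_inverse X) v by rewrite vw qform_mp ?(proj1 Xp) //; apply: (proj2 Xp).
nra.
Qed.

(** By [mp_CS], the square of z . (X w) is at most z^T X z times the
    pseudoinverse form of X w; the inverse of that form is the critical weight. *)
Lemma psd_sub_outer X w (c : R) : psd X -> 0 <= c ->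
  c * qform (mp_inverse X) (X *m w) <= 1 ->
  psd (X - c *: ((X *m w) *m (X *m w)^T)).
Proof.
move=> Xp c0 cq; have [Xs X0] := Xp; set v := X *m w in cq *; split.
  by rewrite linearB linearZ /= trmx_mul trmxK Xs.
move=> z; rewrite qformE mulmxBl dotmBr -qformE -scalemxAl dotmZr.
have -> : dotm z (v *m v^T *m z) = dotm z v ^+ 2.
  by rewrite -mulmxA trmx_mul_dot mul_mx_scalar dotmZr (dotmC v) expr2.
have := mp_CS z w Xp; rewrite -/v; have := X0 z.
set a := qform X z; set q := qform _ v in cq *; set b := dotm z v ^+ 2 => a0 bq.
rewrite subr_ge0; apply: (le_trans (ler_wpM2l c0 bq)).
by rewrite mulrCA ler_piMr.
Qed.

(** With the critical weight, the vector [w] joins the kernel. *)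
Lemma rank_sub_outer X w : psd X -> X *m w != 0 ->
  (\rank (X - (qform (mp_inverse X) (X *m w))^-1 *: ((X *m w) *m (X *m w)^T))%R <
   \rank X)%N.
Proof.
move=> Xp vn; have [Xs X0] := Xp; set v := X *m w in vn *.
rewrite qform_mp //; set q := qform X w; set Y := X - _.
have qn : q != 0.
  apply: contra_neq vn => q0; apply: dotm_eq0; apply/eqP.
  rewrite -sqrf_eq0 eq_le sqr_ge0 andbT.
  by have := psd_CS v w Xp; rewrite -/v -!qformE -/q q0 mulr0.
have YX : Y = (1%:M - q^-1 *: (v *m w^T)) *m X.
  by rewrite mulmxBl mul1mx -scalemxAl -mulmxA /Y trmx_mul Xs.
have Yw : Y *m w = 0.
  rewrite mulmxBl -scalemxAl -mulmxA -/v {2}/v trmx_mul Xs -(mulmxA w^T).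
  rewrite trmx_mul_dot -qformE -/q mul_mx_scalar scalerA mulVf // scale1r.
  by rewrite subrr.
have sYX : (Y <= X)%MS by rewrite YX submxMl.
rewrite ltn_neqAle mxrankS // andbT; apply: contra_neqN vn => e.
have /submxP[F XF] : (X <= Y)%MS by rewrite -(mxrank_leqif_sup sYX) e.
by rewrite /v XF -mulmxA Yw mulmx0.
Qed.

(** What remains of [X] after subtracting the critical multiple of v v^T
    vanishes: in the first case its trace is zero, in the second its rank. *)
Lemma spectrahedron_outer_eq X v : spectrahedron X -> unit_image X v ->
  (qform (mp_inverse X) v == 1) || (\rank X == 1%N) -> X = v *m v^T.
Proof.
move=> XS iv; have [Xp X1] := XS; have q1 := mp_ge1 XS iv.
have [v1 [w vw]] := unit_imageP (proj1 Xp) iv.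
set q := qform _ v in q1 *; have q0 : 0 < q by apply: lt_le_trans q1.
have trY : \tr (X - q^-1 *: (v *m v^T)) = 1 - q^-1.
  by rewrite linearB /= mxtraceZ -dotm_outer v1 X1 mulr1.
have Y0 : X - q^-1 *: (v *m v^T) = 0 -> X = v *m v^T.
  move=> Y0; move: trY; rewrite Y0 mxtrace0 => /esym/subr0_eq q11.
  by move/subr0_eq: Y0; rewrite -q11 scale1r.
case/orP=> [/eqP e1|/eqP r1].
  apply: Y0; apply: psd_tr0; last by rewrite trY e1 invr1 subrr.
  rewrite vw; apply: psd_sub_outer => //; first by rewrite invr_ge0 ltW.
  by rewrite -vw mulVf // gt_eqF.
apply: Y0; apply/eqP; rewrite -mxrank_eq0 -leqn0 -ltnS.
apply: leq_trans (eq_leq r1).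
rewrite /q vw; apply: rank_sub_outer => //; rewrite -vw.
by apply: contra_eqN v1 => /eqP ->; rewrite dotm0l eq_sym oner_eq0.
Qed.

(** Up to the factor 1 + t, this is [X] minus t / (1 + t) times v v^T, and the
    last hypothesis keeps that weight below the critical one. *)
Lemma spectrahedron_away X v (t : R) : spectrahedron X -> unit_image X v ->
  0 <= t -> t * (qform (mp_inverse X) v - 1) <= 1 ->
  spectrahedron (X + t *: (X - v *m v^T)).
Proof.
move=> [Xp X1] /(unit_imageP (proj1 Xp))[v1 [w vw]] t0 tq.
have t1 : 0 < 1 + t by apply: ltr_wpDr.
have -> : X + t *: (X - v *m v^T) = (1 + t) *: (X - (t / (1 + t)) *: (v *m v^T)).
  rewrite !scalerBr scalerDl scale1r scalerA addrA; congr (_ - _ *: _).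
  by rewrite mulrC divfK // gt_eqF.
split.
  apply: psdZ; first exact: ltW.
  rewrite vw; apply: psd_sub_outer; rewrite -?vw //; first by rewrite divr_ge0 // ltW.
  rewrite mulrAC ler_pdivrMr // mul1r; lra.
rewrite mxtraceZ linearB /= mxtraceZ -dotm_outer v1 X1 mulr1.
by field; rewrite gt_eqF.
Qed.

Lemma rank_away X v (t : R) : X^T = X -> unit_image X v ->
  (\rank (X + t *: (X - v *m v^T))%R <= \rank X)%N.
Proof.
move=> Xs /(unit_imageP Xs)[_ [w vw]]; apply: mxrankS.
have -> : X + t *: (X - v *m v^T) = (1%:M + t *: (1%:M - v *m w^T)) *m X.
  by rewrite mulmxDl mul1mx -scalemxAl mulmxBl mul1mx -mulmxA {2}vw trmx_mul Xs.
exact: submxMl.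
Qed.

(** At the full away step the weight is the critical one. *)
Lemma rank_away_drop X v : spectrahedron X -> unit_image X v ->
  let q := qform (mp_inverse X) v in 1 < q ->
  (\rank (X + (q - 1)^-1 *: (X - v *m v^T))%R < \rank X)%N.
Proof.
move=> [Xp X1] /(unit_imageP (proj1 Xp))[v1 [w vw]] q q1.
have -> : X + (q - 1)^-1 *: (X - v *m v^T) =
          (q / (q - 1)) *: (X - q^-1 *: (v *m v^T)).
  rewrite !scalerBr -{1}[X]scale1r addrA -scalerDl scalerA; congr (_ *: _ - _ *: _).
    by field; rewrite subr_eq0 gt_eqF.
  by field; rewrite subr_eq0 !gt_eqF // (lt_trans ltr01).
apply: leq_ltn_trans (mxrankS (scalemx_sub _ (submx_refl _))) _.
rewrite /q vw; apply: rank_sub_outer => //; rewrite -vw.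
by apply: contra_eqN v1 => /eqP ->; rewrite dotm0l eq_sym oner_eq0.
Qed.

Lemma spectrahedron_pair X u z : spectrahedron X -> unit_image X u ->
  dotm z z = 1 ->
  spectrahedron (X + (qform (mp_inverse X) u)^-1 *: (z *m z^T - u *m u^T)).
Proof.
move=> XS iu z1; have [Xp X1] := XS; have q1 := mp_ge1 XS iu.
have [u1 [w uw]] := unit_imageP (proj1 Xp) iu.
set q := qform _ u in q1 *; have q0 : 0 < q by apply: lt_le_trans q1.
have -> : X + q^-1 *: (z *m z^T - u *m u^T) =
    (X - q^-1 *: (u *m u^T)) + q^-1 *: (z *m z^T).
  by rewrite scalerBr addrA addrAC.
split; last first.
  by rewrite mxtraceD linearB /= !mxtraceZ -!dotm_outer u1 z1 X1 subrK.
apply: psdD; last by apply: psdZ; [rewrite invr_ge0 ltW | exact: psd_gram].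
rewrite uw; apply: psd_sub_outer; rewrite -?uw //; first by rewrite invr_ge0 ltW.
by rewrite mulVf // gt_eqF.
Qed.

Lemma rank_pair X u z (c : R) : X^T = X -> unit_image X u ->
  (\rank (X + c *: (z *m z^T - u *m u^T))%R <= (\rank X).+1)%N.
Proof.
move=> Xs /(unit_imageP Xs)[_ [w uw]].
have -> : X + c *: (z *m z^T - u *m u^T) =
    (1%:M - c *: (u *m w^T)) *m X + (c *: z) *m z^T.
  rewrite mulmxBl mul1mx -!scalemxAl -mulmxA scalerBr addrA addrAC.
  by rewrite {2}uw trmx_mul Xs.
apply: leq_trans (mxrank_add _ _) _; rewrite -[(\rank X).+1]addn1 leq_add //.
  exact: mxrankM_maxr.
by apply: leq_trans (mxrankM_maxr _ _) _; exact: rank_leq_row.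
Qed.

Lemma rank_fw X v (t : R) :
  (\rank (X + t *: (v *m v^T - X))%R <= (\rank X).+1)%N.
Proof.
have -> : X + t *: (v *m v^T - X) = ((1 - t)%:M) *m X + (t *: v) *m v^T.
  by rewrite mul_scalar_mx -scalemxAl; apply/matrixP => i j; rewrite !mxE; ring.
apply: leq_trans (mxrank_add _ _) _; rewrite -[(\rank X).+1]addn1 leq_add //.
  exact: mxrankM_maxr.
by apply: leq_trans (mxrankM_maxr _ _) _; exact: rank_leq_row.
Qed.

Lemma spectrahedron_frobenius X : spectrahedron X -> frobenius X <= 1.
Proof.
move=> [Xp X1]; rewrite -[leRHS]sqrtr1 frobeniusE; apply: ler_wsqrtr.
rewrite -{1}(proj1 Xp) -innerE -[leRHS]mul1r -{1 2}X1.
by apply: inner_psd_le => // w; exact: psd_qform_le_tr.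
Qed.

Lemma rank_spectrahedron X : spectrahedron X -> (0 < \rank X)%N.
Proof.
move=> [_ X1]; rewrite lt0n mxrank_eq0; apply: contra_eqN X1 => /eqP ->.
by rewrite mxtrace0 eq_sym oner_eq0.
Qed.

End Spectrahedron.

(** * Unitarily invariant norms *)

Section Norms.
Variables (R : realType) (n : nat) (N : 'M[R]_n -> R).
Hypothesis Nuin : unitarily_invariant_norm N.
Implicit Types (A B G X Y Q : 'M[R]_n) (u v w z : 'cV[R]_n).

Let tri := uin_triangle Nuin.
Let scal := uin_scale Nuin.

Lemma uin_0 : N 0 = 0.
Proof. by rewrite -(scale0r 0) scal normr0 mul0r. Qed.

Lemma uin_opp A : N (- A) = N A.
Proof. by rewrite -scaleN1r scal normrN1 mul1r. Qed.

Lemma uin_ge0 A : 0 <= N A.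
Proof.
have := tri A (- A); rewrite subrr uin_0 uin_opp -mulr2n.
by rewrite pmulrn_lge0.
Qed.

Lemma uin_gt0 A : A != 0 -> 0 < N A.
Proof.
by move=> A0; rewrite lt_neqAle uin_ge0 andbT eq_sym; apply: contra_neq A0 => /(uin_definite Nuin).
Qed.

Lemma uin_sum (I : Type) (r : seq I) (F : I -> 'M[R]_n) :
  N (\sum_(i <- r) F i) <= \sum_(i <- r) N (F i).
Proof.
elim: r => [|i r IH]; first by rewrite !big_nil uin_0.
by rewrite !big_cons; apply: le_trans (tri _ _) _; rewrite lerD2l.
Qed.

Let reflection Q : Q^T = Q -> Q *m Q = Q ->
  (2 *: Q - 1%:M) *m (2 *: Q - 1%:M)^T = 1%:M.
Proof.
move=> Qs QQ; rewrite linearB linearZ /= trmx1 Qs mulmxBl !mulmxBr -!scalemxAl -!scalemxAr.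
by rewrite QQ !mulmx1 mul1mx; apply/matrixP => i j; rewrite !mxE; ring.
Qed.

Let mean_le A B C : A = 2^-1 *: (B + C) -> N C = N B -> N A <= N B.
Proof.
move=> -> CB; rewrite scal ger0_norm ?invr_ge0 //.
by have := tri B C; rewrite CB; lra.
Qed.

(** An orthogonal projection is the mean of the identity and a reflection. *)
Lemma uin_proj_mul Q A : Q^T = Q -> Q *m Q = Q -> N (Q *m A) <= N A.
Proof.
move=> Qs QQ; apply: (@mean_le _ A ((2 *: Q - 1%:M) *m A *m 1%:M)).
  rewrite mulmx1 mulmxBl -scalemxAl mul1mx; apply/matrixP => i j; rewrite !mxE.
  by field.
by rewrite (uin_invariant Nuin) ?reflection ?trmx1 ?mulmx1.
Qed.

Lemma uin_mul_proj Q A : Q^T = Q -> Q *m Q = Q -> N (A *m Q) <= N A.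
Proof.
move=> Qs QQ; apply: (@mean_le _ A (1%:M *m A *m (2 *: Q - 1%:M))).
  rewrite mul1mx mulmxBr -scalemxAr mulmx1; apply/matrixP => i j; rewrite !mxE.
  by field.
by rewrite (uin_invariant Nuin) ?reflection ?trmx1 ?mulmx1.
Qed.

Let delta_proj i : (delta_mx i i : 'M[R]_n)^T = delta_mx i i /\
  delta_mx i i *m delta_mx i i = delta_mx i i :> 'M[R]_n.
Proof. by rewrite trmx_delta mul_delta_mx. Qed.

(** Two diagonal projections cut out the entry. The bounds that this gives
    replace the equivalence of norms in finite dimension: they make the suprema
    defining the diameter, the dual norm and [kappa] finite. *)
Lemma uin_entry i j A : `|A i j| * N (delta_mx i j) <= N A.
Proof.
rewrite -scal; have [ds dd] := delta_proj i; have [es ee] := delta_proj j.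
have -> : A i j *: delta_mx i j = delta_mx i i *m (A *m delta_mx j j).
  have e : (delta_mx 0 i : 'rV[R]_n) *m A *m (delta_mx j 0 : 'cV[R]_n) = (A i j)%:M.
    by rewrite -rowE -colE [LHS]mx11_scalar !mxE.
  transitivity ((delta_mx i 0 : 'cV[R]_n) *m
      ((delta_mx 0 i : 'rV[R]_n) *m A *m (delta_mx j 0 : 'cV[R]_n)) *m
      (delta_mx 0 j : 'rV[R]_n)).
    by rewrite e mul_mx_scalar -scalemxAl mul_delta_mx.
  by rewrite !mulmxA mul_delta_mx -!mulmxA mul_delta_mx.
apply: le_trans (uin_proj_mul _ ds dd) _.
exact: uin_mul_proj.
Qed.

Lemma frobenius_le_uin : exists2 C : R, 0 < C & forall A, frobenius A <= C * N A.
Proof.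
pose c := \sum_i \sum_j (N (delta_mx i j))^-1.
have Nd i j : 0 < N (delta_mx i j).
  apply: uin_gt0; apply/eqP => /matrixP/(_ i j)/eqP.
  by rewrite !mxE !eqxx oner_eq0.
have c0 : 0 <= c.
  by apply: sumr_ge0 => i _; apply: sumr_ge0 => j _; rewrite invr_ge0 ltW.
have cA A i j : `|A i j| <= c * N A.
  apply: (@le_trans _ _ ((N (delta_mx i j))^-1 * N A)).
    by rewrite mulrC ler_pdivlMr //; exact: uin_entry.
  rewrite ler_wpM2r ?uin_ge0 // /c (bigD1 i) //= (bigD1 j) //= -addrA lerDl.
  rewrite addr_ge0 // ?sumr_ge0 // => *; first by rewrite invr_ge0 ltW.
  by apply: sumr_ge0 => *; rewrite invr_ge0 ltW.
exists (n%:R * c + 1); first by rewrite ltr_wpDl // mulr_ge0.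
move=> A; apply: (@le_trans _ _ (n%:R * c * N A)); last first.
  by rewrite ler_wpM2r ?uin_ge0 // lerDl.
rewrite -[leRHS]ger0_norm; last by rewrite !mulr_ge0 ?uin_ge0.
rewrite -sqrtr_sqr; apply: ler_wsqrtr.
apply: (@le_trans _ _ (\sum_(i < n) \sum_(j < n) (c * N A) ^+ 2)).
  apply: ler_sum => i _; apply: ler_sum => j _.
  by rewrite -real_normK ?num_real // ler_pXn2r ?nnegrE ?mulr_ge0 ?uin_ge0.
rewrite !sumr_const card_ord -mulrnA -[leLHS]mulr_natl natrM.
by rewrite le_eqVlt; apply/orP; left; apply/eqP; ring.
Qed.

Lemma uin_le_frobenius : exists2 C : R, 0 < C & forall A, N A <= C * frobenius A.
Proof.
pose C := 1 + \sum_i \sum_j N (delta_mx i j).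
have C0 : 0 < C.
  rewrite ltr_pwDl // sumr_ge0 // => i _; rewrite sumr_ge0 // => j _; exact: uin_ge0.
exists C => // A; rewrite {1}(matrix_sum_delta A).
apply: le_trans (uin_sum _ _) _.
apply: (@le_trans _ _ (\sum_i \sum_j N (delta_mx i j) * frobenius A)).
  apply: ler_sum => i _; apply: le_trans (uin_sum _ _) _; apply: ler_sum => j _.
  by rewrite scal mulrC ler_wpM2l ?uin_ge0 // entry_le_frobenius.
rewrite mulrDl mul1r.
under eq_bigr do rewrite -mulr_suml.
by rewrite -mulr_suml lerDr frobenius_ge0.
Qed.

Lemma diameter_has_sup X0 : spectrahedron X0 -> 
  has_sup [set N (X - Y) | X in @spectrahedron R n & Y in @spectrahedron R n].
Proof.
have [C C0 CN] := uin_le_frobenius.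
move=> X0S; split; first by exists (N (X0 - X0)), X0 => //; exists X0.
exists (C + C) => _ [X XS [Y YS <-]].
apply: le_trans (tri _ _) _; rewrite uin_opp lerD //.
  by apply: le_trans (CN _) _; rewrite ger_pMr // spectrahedron_frobenius.
by apply: le_trans (CN _) _; rewrite ger_pMr // spectrahedron_frobenius.
Qed.

Lemma uin_le_diameter X Y : spectrahedron X -> spectrahedron Y ->
  N (X - Y) <= diameter N.
Proof.
move=> XS YS; apply: sup_upper_bound; first exact: diameter_has_sup XS.
by exists X => //; exists Y.
Qed.

Let dual_set A := [set inner A B | B in [set B | B^T = B /\ N B <= 1]].

Lemma dual_has_sup A : A^T = A -> has_sup (dual_set A).
Proof.
have [C C0 CN] := frobenius_le_uin.
move=> As; split.
  by exists (inner A 0), 0 => //; rewrite /= trmx0 uin_0 ler01.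
exists (frobenius A * C) => _ [B [Bs B1] <-].
apply: le_trans (ler_norm _) _; apply: le_trans (inner_CS _ As) _.
rewrite ler_wpM2l ?frobenius_ge0 //; apply: le_trans (CN _) _.
by rewrite ger_pMr.
Qed.

Lemma inner_le_dual A B : A^T = A -> B^T = B ->
  inner A B <= dual_norm N A * N B.
Proof.
move=> As Bs; have [->|B0] := eqVneq B 0.
  by rewrite uin_0 mulr0 /inner mulmx0 mxtrace0.
have NB := uin_gt0 B0.
rewrite -ler_pdivrMr //; apply: sup_upper_bound; first exact: dual_has_sup.
exists ((N B)^-1 *: B); last by rewrite /inner -scalemxAr mxtraceZ mulrC.
split; first by rewrite linearZ /= Bs.
by rewrite scal ger0_norm ?invr_ge0 ?uin_ge0 // mulVf // gt_eqF.
Qed.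

Lemma dual_ge0 A : A^T = A -> 0 <= dual_norm N A.
Proof.
move=> As; apply: sup_upper_bound; first exact: dual_has_sup.
by exists 0; rewrite /= ?trmx0 ?uin_0 ?ler01 // /inner mulmx0 mxtrace0.
Qed.

Lemma frobenius_le_dual : exists2 C : R, 0 < C &
  forall A, A^T = A -> frobenius A <= C * dual_norm N A.
Proof.
have [C C0 CN] := uin_le_frobenius; exists C => // A As.
have := frobenius_ge0 A; rewrite le_eqVlt => /orP[/eqP <-|A0].
  by rewrite mulr_ge0 ?dual_ge0 // ltW.
rewrite -(ler_pM2r A0) -expr2 frobenius_sqr -{1}As -innerE.
apply: le_trans (inner_le_dual As As) _.
rewrite -mulrA mulrCA ler_wpM2l ?dual_ge0 //.
Qed.

Lemma frobenius_le_kappa r A : A^T = A -> (\rank A <= 2 * r)%N ->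
  frobenius A <= kappa N r * N A.
Proof.
move=> As Ar; have [->|A0] := eqVneq A 0.
  rewrite uin_0 mulr0 -[leRHS]sqrtr0 frobeniusE; apply: ler_wsqrtr.
  by rewrite dotm0l.
have [C C0 CN] := frobenius_le_uin.
rewrite -ler_pdivrMr ?uin_gt0 //; apply: sup_upper_bound.
  split; first by exists (frobenius A / N A), A.
  exists C => _ [B [Bs B0 _] <-]; by rewrite ler_pdivrMr ?uin_gt0.
by exists A.
Qed.

Lemma spectral_norm_ge A v : norm2 v = 1 -> norm2 (A *m v) <= spectral_norm A.
Proof.
move=> v1; apply: sup_upper_bound; last by exists v.
split; first by exists (norm2 (A *m v)), v.
by exists (frobenius A) => _ [z z1 <-]; exact: norm2_mul_le.
Qed.

End Norms.

(** * Smooth convex functions on the spectrahedron *)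

Section Smooth.
Variables (R : realType) (n : nat) (N f : 'M[R]_n -> R).
Variables (grad : 'M[R]_n -> 'M[R]_n) (beta : R).
Hypothesis Nuin : unitarily_invariant_norm N.
Hypothesis f_convex : convex_function (@spectrahedron R n) f.
Hypothesis f_grad :
  forall Y : 'M[R]_n, spectrahedron Y -> is_gradient f Y (grad Y).
Hypothesis f_smooth : smooth N beta grad.
Implicit Types (X Y Z : 'M[R]_n) (u v w : 'cV[R]_n).

Lemma convex_le X Y (t : R) : spectrahedron X -> spectrahedron Y ->
  0 <= t <= 1 -> f (X + t *: (Y - X)) <= f X + t * (f Y - f X).
Proof.
move=> XS YS /andP[t0 t1].
have := f_convex (Itv01 t0 t1) (mem_set YS) (mem_set XS).
rewrite convRE /= /unstable.onem.
have -> : conv (Itv01 t0 t1) (Y : convex_lmodType 'M[R]_n)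
    (X : convex_lmodType 'M[R]_n) = X + t *: (Y - X).
  by rewrite /conv /= /unstable.onem scalerBr scalerBl scale1r addrCA.
by move=> /le_trans; apply; rewrite le_eqVlt; apply/orP; left; apply/eqP; ring.
Qed.

Lemma grad_sym X : spectrahedron X -> (grad X)^T = grad X.
Proof. by move=> /f_grad[]. Qed.

(** Compare convexity with the first-order expansion at a point at distance [t]
    along the segment, and divide by [t]. *)
Lemma gradient_le X Y : spectrahedron X -> spectrahedron Y ->
  f X + inner (grad X) (Y - X) <= f Y.
Proof.
move=> XS YS; have [Gs Gd] := f_grad XS.
set a := inner _ _; rewrite addrC -lerBrDr -subr_le0.
have nn : 0 < `|Y - X| + 1 by rewrite ltr_wpDl.
apply/ler_addgt0Pl => e e0; rewrite addr0.
pose e' := e / (`|Y - X| + 1); have e'0 : 0 < e' by rewrite divr_gt0.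
have := Gd; move=> /eqoP/(_ e' e'0); rewrite near_withinE => /nbhs_normP[d /= d0 dU].
pose t := Num.min 1 (d / (2 * (`|Y - X| + 1))).
have t0 : 0 < t by rewrite lt_min ltr01 divr_gt0 // mulr_gt0.
have t1 : t <= 1 by rewrite ge_min lexx.
have td : t * `|Y - X| < d.
  have : t <= d / (2 * (`|Y - X| + 1)) by rewrite ge_min lexx orbT.
  rewrite ler_pdivlMr ?mulr_gt0 // => h.
  have := normr_ge0 (Y - X); nra.
pose Z := X + t *: (Y - X).
have Zs : Z^T = Z.
  by apply: spectrahedron_sym; apply: spectrahedron_conv => //; rewrite (ltW t0).
have := dU Z.
rewrite /ball_ /= opprD addrA subrr sub0r normrN normrZ gtr0_norm // => /(_ td Zs).
have ZX : Z - X = t *: (Y - X) by rewrite /Z addrAC subrr add0r.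
rewrite ZX normrZ gtr0_norm // /inner -scalemxAr mxtraceZ -/(inner _ _) -/a.
have := convex_le XS YS (t := t); rewrite (ltW t0) t1 => /(_ erefl) cv h.
have {}h : t * a <= t * (f Y - f X) + t * e.
  move: h; rewrite ler_norml => /andP[h _].
  have : e' * (t * `|Y - X|) <= t * e.
    rewrite mulrCA ler_pM2l // /e' mulrAC ler_pdivrMr //.
    by rewrite ler_pM2l // lerDl.
  lra.
by move: h; rewrite -mulrDr ler_pM2l // => h; rewrite lerBlDl.
Qed.


Lemma gradient_lipschitz X Y B : spectrahedron X -> spectrahedron Y -> B^T = B ->
  inner (grad Y) B <= inner (grad X) B + beta * N (Y - X) * N B.
Proof.
move=> XS YS Bs; rewrite -lerBlDl -innerBl.
apply: le_trans (inner_le_dual Nuin _ Bs) _.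
  by rewrite linearB /= !grad_sym.
by rewrite ler_wpM2r ?(uin_ge0 Nuin) // f_smooth.
Qed.

(** Convexity stands in for integrating the gradient: cut the segment in [m]
    equal steps, bound each by the slope at its end, and let [m] grow. *)
Lemma descent X Y : spectrahedron X -> spectrahedron Y ->
  f Y <= f X + inner (grad X) (Y - X) + beta / 2 * N (Y - X) ^+ 2.
Proof.
move=> XS YS; set a := inner _ _; set b := beta * N (Y - X) ^+ 2.
have Bs : (Y - X)^T = Y - X by rewrite linearB /= !spectrahedron_sym.
have step (m : nat) : (0 < m)%N -> f Y <= f X + a + b / 2 + b / 2 / m%:R.
  move=> m0; have mR : 0 < m%:R :> R by rewrite ltr0n.
  pose Z k := X + (k%:R / m%:R) *: (Y - X).
  have ZS k : (k <= m)%N -> spectrahedron (Z k).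
    move=> km; apply: spectrahedron_conv => //.
    by rewrite divr_ge0 //= ler_pdivrMr // mul1r ler_nat.
  have Zf k : (k <= m)%N ->
      f (Z k) <= f X + k%:R / m%:R * a + b / m%:R ^+ 2 * (k%:R * (k%:R + 1) / 2).
    elim: k => [_|k IH km].
      by rewrite /Z !mul0r scale0r mulr0 !addr0.
    have {}IH := IH (ltnW km); have ZS1 := ZS _ km; have ZS0 := ZS _ (ltnW km).
    have := gradient_le ZS1 ZS0.
    have -> : Z k - Z k.+1 = - m%:R^-1 *: (Y - X).
      by apply/matrixP => i j; rewrite !mxE -natr1; field; rewrite gt_eqF.
    rewrite /inner -scalemxAr mxtraceZ -/(inner _ _) => h1.
    have := gradient_lipschitz XS ZS1 Bs; rewrite -/a.
    have -> : Z k.+1 - X = (k.+1%:R / m%:R) *: (Y - X).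
      by rewrite /Z addrAC subrr add0r.
    rewrite (uin_scale Nuin) ger0_norm ?divr_ge0 // => h2.
    have h3 : f (Z k.+1) <= f (Z k) + m%:R^-1 * (a + b * (k.+1%:R / m%:R)).
      have : m%:R^-1 * inner (grad (Z k.+1)) (Y - X) <=
             m%:R^-1 * (a + b * (k.+1%:R / m%:R)).
        rewrite ler_pM2l ?invr_gt0 //; apply: le_trans h2 _.
        by rewrite le_eqVlt; apply/orP; left; apply/eqP; rewrite /b; ring.
      lra.
    apply: le_trans h3 _; apply: le_trans (lerD IH (lexx _)) _.
    rewrite le_eqVlt; apply/orP; left; apply/eqP; rewrite -natr1; field.
    by rewrite gt_eqF.
  have := Zf m (leqnn m).
  rewrite /Z divff ?gt_eqF // scale1r addrC subrK mul1r => /le_trans; apply.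
  rewrite le_eqVlt; apply/orP; left; apply/eqP; field.
  by rewrite gt_eqF.
apply/ler_addgt0Pr => e e0.
have [m mb] : exists m : nat, `|b / 2| / e < m%:R.
  by exists (Num.bound (`|b / 2| / e)); rewrite archi_boundP // divr_ge0 // ltW.
have m0 : (0 < m)%N.
  by rewrite -(ltr0n R); apply: le_lt_trans mb; rewrite divr_ge0 // ltW.
apply: le_trans (step m m0) _.
rewrite (_ : beta / 2 * _ = b / 2); last by rewrite /b; ring.
rewrite -!addrA !lerD2l ler_pdivrMr ?ltr0n //.
apply: le_trans (ler_norm _) _; rewrite ltr_pdivrMr // in mb.
by rewrite (mulrC e) ltW.
Qed.

Let D := diameter N.

Lemma diameter_ge0 X : spectrahedron X -> 0 <= D.
Proof.
by move=> XS; apply: le_trans (uin_le_diameter Nuin XS XS); exact: uin_ge0.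
Qed.

Lemma smooth_uin_ge0 X Y : spectrahedron X -> spectrahedron Y ->
  0 <= beta * N (X - Y).
Proof.
move=> XS YS; apply: le_trans (f_smooth XS YS).
by apply: (dual_ge0 Nuin); rewrite linearB /= !grad_sym.
Qed.

Lemma smooth_le_diameter X Y : spectrahedron X -> spectrahedron Y ->
  beta * N (X - Y) ^+ 2 <= beta * D ^+ 2.
Proof.
move=> XS YS; have Nge := uin_ge0 Nuin (X - Y).
have ND := uin_le_diameter Nuin XS YS; rewrite -/D in ND.
have [b0|b0] := leP 0 beta.
  by apply: ler_wpM2l => //; rewrite ler_pXn2r // nnegrE // (le_trans Nge).
(* A negative constant forces the spectrahedron to be a single point. *)
have N0 X1 Y1 : spectrahedron X1 -> spectrahedron Y1 -> N (X1 - Y1) = 0.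
  move=> XS1 YS1; apply/eqP; rewrite eq_le uin_ge0 // andbT.
  by have := smooth_uin_ge0 XS1 YS1; rewrite nmulr_rge0.
suff -> : D = 0 by rewrite N0.
apply/eqP; rewrite eq_le (diameter_ge0 XS) andbT; apply: ge_sup.
  by exists (N (X - X)), X => //; exists X.
by move=> _ [X1 XS1 [Y1 YS1 <-]]; rewrite N0.
Qed.

Lemma smooth_diameter_ge0 X : spectrahedron X -> 0 <= beta * D ^+ 2.
Proof.
move=> XS; apply: le_trans (smooth_le_diameter XS XS).
by rewrite expr2 mulrA mulr_ge0 ?uin_ge0 // smooth_uin_ge0.
Qed.


(** This makes the supremum defining [Gtilde] finite. *)
Lemma grad_bounded X0 : spectrahedron X0 ->
  exists M : R, forall Y, spectrahedron Y -> frobenius (grad Y) <= M.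
Proof.
move=> XS0; have [C1 C10 CN1] := frobenius_le_dual Nuin.
have [C2 C20 CN2] := uin_le_frobenius Nuin.
have [C3 C30 CN3] := frobenius_le_uin Nuin.
exists (C3 * (C2 * (C1 * (`|beta| * D)) + N (grad X0))) => Y YS.
apply: le_trans (CN3 _) _; rewrite ler_pM2l //.
rewrite -{1}(subrK (grad X0) (grad Y)).
apply: le_trans (uin_triangle Nuin _ _) _; rewrite lerD2r.
apply: le_trans (CN2 _) _; rewrite ler_pM2l //.
apply: le_trans (CN1 _ _) _; first by rewrite linearB /= !grad_sym.
rewrite ler_pM2l //; apply: le_trans (f_smooth YS XS0) _.
apply: (@le_trans _ _ (`|beta| * N (Y - X0))).
  by rewrite ler_wpM2r ?(uin_ge0 Nuin) // ler_norm.
by rewrite ler_wpM2l // (uin_le_diameter Nuin).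
Qed.

Lemma norm2_shifted_le (G : 'M[R]_n) v : G^T = G -> norm2 v = 1 ->
  norm2 (shifted_grad G *m v) <= 2 * frobenius G.
Proof.
move=> Gs /norm2_eq1 v1; have n0 := unit_dim_gt0 v1.
have [z z1 Gz] := min_eigvector Gs n0.
rewrite -[leRHS]ger0_norm ?mulr_ge0 ?frobenius_ge0 // -sqrtr_sqr norm2E.
apply: ler_wsqrtr; rewrite exprMn frobenius_sqr /shifted_grad mulmxBl mul_scalar_mx.
have h1 : dotm (G *m v) (G *m v) <= dotm G G.
  by have := dotm_mulvv G v; rewrite v1 mulr1.
have h2 : eigval n G ^+ 2 <= dotm G G.
  by have := dotm_mulvv G z; rewrite z1 mulr1 Gz dotmZl dotmZr z1 mulr1 -expr2.
have := dotm_ge0 (G *m v + eigval n G *: v).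
rewrite !dotmDl !dotmDr !dotmNl !dotmNr !dotmZl !dotmZr v1 (dotmC v).
set c := eigval n G in h2 *; set p := dotm (_ *m _) v; set q := dotm (_ *m _) _ in h1 *.
set F := dotm G G in h1 h2 *; lra.
Qed.

Lemma Gtilde_ge X v : spectrahedron X -> norm2 v = 1 ->
  norm2 (shifted_grad (grad X) *m v) <= Gtilde grad.
Proof.
move=> XS v1; apply: le_trans (spectral_norm_ge _ v1) _.
apply: sup_upper_bound; last by exists X.
split; first by exists (spectral_norm (shifted_grad (grad X))), X.
have [M MP] := grad_bounded XS.
exists (2 * M) => _ [Y YS <-].
apply: ge_sup; first by exists (norm2 (shifted_grad (grad Y) *m v)), v.
move=> _ [z /= z1 <-]; apply: le_trans (norm2_shifted_le (grad_sym YS) z1) _.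
by rewrite ler_pM2l // MP.
Qed.

Lemma Gtilde_ge0 X v : spectrahedron X -> norm2 v = 1 -> 0 <= Gtilde grad.
Proof. by move=> XS v1; apply: le_trans (Gtilde_ge XS v1); exact: norm2_ge0. Qed.

Lemma inner_shifted G X Y : spectrahedron X -> spectrahedron Y ->
  inner (shifted_grad G) (Y - X) = inner G (Y - X).
Proof.
move=> [_ X1] [_ Y1]; rewrite /shifted_grad innerBl inner_scalar.
by rewrite linearB /= X1 Y1 subrr mulr0 subr0.
Qed.

Lemma duality_gap X Y : spectrahedron X -> spectrahedron Y ->
  f X - f Y <= inner (shifted_grad (grad X)) (X - Y).
Proof.
move=> XS YS; rewrite inner_shifted // -opprB !innerBr.
have := gradient_le XS YS; rewrite innerBr; lra.
Qed.

Lemma optval_ge X : spectrahedron X ->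
  f X - inner (shifted_grad (grad X)) X <= optval f.
Proof.
move=> XS; apply: lb_le_inf; first by exists (f X), X.
move=> _ [Y YS <-]; have := duality_gap XS YS; rewrite innerBr.
have := inner_psd_ge0 (psd_shifted_grad (grad_sym XS)) (proj1 YS); lra.
Qed.

Lemma optval_le X : spectrahedron X -> optval f <= f X.
Proof.
move=> XS; apply: ge_inf; last by exists X.
exists (f X - inner (shifted_grad (grad X)) X) => _ [Y YS <-].
have := duality_gap XS YS; rewrite innerBr.
have := inner_psd_ge0 (psd_shifted_grad (grad_sym XS)) (proj1 YS); lra.
Qed.

End Smooth.

(** * Projections, aligned factors *)

Section Projection.
Variables (R : realType) (n r : nat).

(** Project onto the range of A A^T + B B^T, which contains those of [A] and
    [B]. *)
Lemma range_projection (A B : 'M[R]_(n, r)) :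
  exists Q : 'M[R]_n, [/\ Q^T = Q, Q *m Q = Q, Q *m A = A, Q *m B = B &
    (\rank Q <= 2 * r)%N].
Proof.
pose S := A *m A^T + B *m B^T.
have Ss : S^T = S by rewrite /S linearD /= !trmx_mul !trmxK.
have [SS1 SS2 SS3 _] := mp_inverse_spec Ss; set P := mp_inverse S in SS1 SS2 SS3.
pose Q := S *m P; have QS : Q *m S = S by [].
have Qs : Q^T = Q by [].
pose T := 1%:M - Q; have Ts : T^T = T by rewrite /T linearB /= trmx1 Qs.
have TS : T *m S = 0 by rewrite /T mulmxBl mul1mx QS subrr.
have e (C : 'M[R]_(n, r)) : dotm (T *m C) (T *m C) = \tr (T *m (C *m C^T) *m T).
  by rewrite dotm_outer trmx_mul Ts !mulmxA.
have : dotm (T *m A) (T *m A) + dotm (T *m B) (T *m B) == 0.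
  rewrite !e -mxtraceD -mulmxDl -mulmxDr -/S TS mul0mx mxtrace0 //.
rewrite paddr_eq0 ?dotm_ge0 // => /andP[/eqP/dotm_eq0 TA /eqP/dotm_eq0 TB].
have TQ (C : 'M[R]_(n, r)) : T *m C = 0 -> Q *m C = C.
  by rewrite mulmxBl mul1mx => /subr0_eq/esym.
exists Q; split; [by [] | by rewrite /Q mulmxA SS1 | exact: TQ | exact: TQ |].
apply: leq_trans (mxrankM_maxl _ _) _; apply: leq_trans (mxrank_add _ _) _.
rewrite mul2n -addnn; apply: leq_add; apply: leq_trans (mxrankM_maxl _ _) (rank_leq_col _).
Qed.

End Projection.

Section Procrustes.
Variables (R : realType) (n r : nat) (U V : 'M[R]_(n, r)).

(** With H = U - V, P = H^T H, S = H^T V and t = sqrt 2, the right-hand side is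
    |P + t S|^2 + (4 - 2 t) <P, U^T V> + 2 (t - 1) <P, V^T V>. Alignment, which is
    the first hypothesis, makes the middle term nonnegative. *)
Lemma procrustes (c : R) : psd (U^T *m V) ->
  (forall z : 'cV[R]_r, c * dotm z z <= qform (V^T *m V) z) ->
  2 * (Num.sqrt 2 - 1) * c * dotm (U - V) (U - V) <=
  dotm (U *m U^T - V *m V^T) (U *m U^T - V *m V^T).
Proof.
move=> Bp Wc; set H := U - V; pose P := H^T *m H.
pose A := U^T *m U; pose B := U^T *m V; pose W := V^T *m V; pose S := B - W.
have Bs : V^T *m U = B by rewrite /B -[RHS](proj1 Bp) trmx_mul trmxK.
have AE : A = P + 2 *: S + W.
  have HT : H^T = U^T - V^T by rewrite /H linearB.
  rewrite /P HT /H mulmxBl !mulmxBr Bs -/A -/B -/W /S.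
  by apply/matrixP => i j; rewrite !mxE; ring.
have -> : dotm (U *m U^T - V *m V^T) (U *m U^T - V *m V^T) =
    dotm A A - 2 * dotm B B + dotm W W.
  rewrite dotmBl !dotmBr !dotm_gram Bs -/A -/B -/W; ring.
have BE : B = S + W by rewrite /S subrK.
have s2 : Num.sqrt 2 ^+ 2 = 2 :> R by rewrite sqr_sqrtr.
set t : R := Num.sqrt 2 in s2 *.
have t1 : 1 <= t by rewrite -[leLHS]sqrtr1; apply: ler_wsqrtr; rewrite ler1n.
have t2 : t <= 2 by rewrite -(ler_pXn2r (n := 2)) ?nnegrE ?(le_trans ler01) //; lra.
have PB : 0 <= dotm P B.
  rewrite dotmC -(proj1 Bp : B^T = B) -innerE; apply: inner_psd_ge0 => //.
  have -> : P = H^T *m (H^T)^T by rewrite trmxK.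
  exact: psd_gram.
have PW : c * dotm H H <= dotm P W.
  have := @qform_lower_dotm _ _ W c _ H^T Wc; rewrite dotm_tr => /le_trans; apply.
  by rewrite dotm_mulr trmxK.
have sq := dotm_ge0 (P + t *: S).
have PSE : dotm P S = dotm P B - dotm P W by rewrite -dotmBr.
have h1 : (t - 1) * (c * dotm H H) <= (t - 1) * dotm P W by rewrite ler_wpM2l //; lra.
have h2 : 0 <= (2 - t) * dotm P B by rewrite mulr_ge0 //; lra.
have expand (P1 S1 W1 : 'M[R]_r) :
    dotm (P1 + 2 *: S1 + W1) (P1 + 2 *: S1 + W1) - 2 * dotm (S1 + W1) (S1 + W1) +
    dotm W1 W1 = dotm P1 P1 + 2 * dotm S1 S1 + 4 * dotm P1 S1 + 2 * dotm P1 W1.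
  rewrite !dotmDl !dotmDr !dotmZl !dotmZr (dotmC S1 P1) (dotmC W1 P1) (dotmC W1 S1).
  ring.
have sqE (P1 S1 : 'M[R]_r) : dotm (P1 + t *: S1) (P1 + t *: S1) =
    dotm P1 P1 + 2 * t * dotm P1 S1 + 2 * dotm S1 S1.
  transitivity (dotm P1 P1 + 2 * t * dotm P1 S1 + t ^+ 2 * dotm S1 S1).
    by rewrite !dotmDl !dotmDr !dotmZl !dotmZr (dotmC S1 P1); ring.
  by rewrite s2.
move: sq; have := expand P S W; rewrite -AE -BE => ->; rewrite sqE PSE.
lra.
Qed.

End Procrustes.

Section Factor.
Variables (R : realType) (n r : nat).

Lemma rank_diag_ge (d : 'rV[R]_n) (k : nat) : (k <= n)%N ->
  (forall i : 'I_n, (i < k)%N -> d 0 i != 0) -> (k <= \rank (diag_mx d))%N.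
Proof.
move=> kn dk; rewrite -{1}(@rank_pid_mx R n n k) //.
have -> : (pid_mx k : 'M[R]_n) = (pid_mx k *m diag_mx (\row_i (d 0 i)^-1)) *m diag_mx d.
  rewrite -mulmxA mulmx_diag mul_mx_diag; apply/matrixP => i j; rewrite !mxE.
  case: eqP => [eij|]; last by rewrite mul0r.
  case: ltnP => [ik|]; last by rewrite mul0r.
  rewrite mulVf ?mulr1 //; apply: dk.
  by rewrite -(val_inj eij : i = j).
exact: mxrankM_maxr.
Qed.

(** The Gram matrix of a factor of [Y] has the nonzero eigenvalues of [Y]. The
    factor is free up to a rotation of its columns, which is spent on
    diagonalizing the form [A]. *)
Lemma adapted_factor (A Y : 'M[R]_n) : A^T = A -> psd Y -> \rank Y = r ->
  (0 < r <= n)%N ->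
  exists (V : 'M[R]_(n, r)) (m : 'rV[R]_r),
    [/\ V *m V^T = Y, V^T *m A *m V = diag_mx m &
        forall z : 'cV[R]_r, eigval r Y * dotm z z <= qform (V^T *m V) z].
Proof.
move=> As Yp Yr /andP[r0 rn]; have [Ys Y0] := Yp.
have [W WW YE] := spectral_eigval Ys.
pose d : 'rV[R]_n := \row_i eigval i.+1 Y; rewrite -/d in YE.
have d0 i : 0 <= d 0 i by rewrite mxE; apply: eigval_ge0 => //=; exact: ltn_ord.
have dr (i : 'I_n) : (r <= i)%N -> d 0 i = 0.
  move=> ri; apply/eqP; apply: contraLR (leqnn r) => di; rewrite -ltnNge.
  have rkY : (\rank (diag_mx d) <= \rank Y)%N.
    have -> : diag_mx d = W^T *m Y *m W.
      by rewrite YE !mulmxA WW mul1mx -mulmxA WW mulmx1.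
    by apply: leq_trans (mxrankM_maxl _ _) (mxrankM_maxr _ _).
  rewrite -{2}Yr; apply: leq_trans rkY; apply: leq_trans (_ : r < i.+1)%N _ => //.
  apply: rank_diag_ge => [|j ji]; first exact: ltn_ord.
  have dji : d 0 i <= d 0 j.
    by rewrite !mxE; apply: eigval_le => //; exact: ltn_ord.
  by rewrite gt_eqF //; apply: lt_le_trans dji; rewrite lt_neqAle eq_sym di d0.
have dlow (i : 'I_n) : (i < r)%N -> eigval r Y <= d 0 i.
  by move=> ir; rewrite mxE; apply: eigval_le.
clearbody d.
pose J : 'M[R]_(n, r) := pid_mx r.
pose s := diag_mx (\row_i Num.sqrt (d 0 i)).
have JJ : J^T *m J = 1%:M.
  by rewrite /J tr_pid_mx mul_pid_mx minnn (minn_idPr rn) pid_mx_1.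
pose V0 := W *m s *m J.
have V0Y : V0 *m V0^T = Y.
  rewrite YE /V0 !trmx_mul tr_diag_mx -!mulmxA; congr (_ *m _); rewrite !mulmxA; congr (_ *m _).
  rewrite -(mulmxA s) /J tr_pid_mx mul_pid_mx !minnn.
  rewrite mul_mx_diag mul_diag_mx; apply/matrixP => i j; rewrite !mxE.
  have -> : (nat_of_ord i == j) = (i == j) by [].
  have [->|ij] := eqVneq i j; last by rewrite mulr0 mul0r.
  case: (ltnP j r) => [jr|jr] /=; last by rewrite dr // mulr0 mul0r.
  by rewrite mulr1 -expr2 sqr_sqrtr.
have V0low (z : 'cV[R]_r) : eigval r Y * dotm z z <= dotm (V0 *m z) (V0 *m z).
  have -> : dotm (V0 *m z) (V0 *m z) = dotm (J *m z) (diag_mx d *m (J *m z)).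
    rewrite /V0 -!mulmxA dotm_mull mulmxA WW mul1mx dotm_mull tr_diag_mx mulmxA.
    rewrite mulmx_diag dotmC; congr (dotm _ (diag_mx _ *m _)).
    by apply/rowP => i; rewrite !mxE -expr2 sqr_sqrtr.
  have -> : dotm z z = dotm (J *m z) (J *m z) by rewrite dotm_mull mulmxA JJ mul1mx.
  rewrite !dotmE !big_ord1 mulr_sumr; apply: ler_sum => i _.
  rewrite mul_diag_mx [X in _ <= _ * X]mxE [leRHS]mulrCA.
  have [ri|ir] := leqP r i.
    rewrite (_ : (J *m z) i 0 = 0) ?mulr0 // mxE big1 // => j _.
    by rewrite mxE [(i < r)%N]ltnNge ri andbF mul0r.
  apply: ler_wpM2r; first by rewrite -expr2 sqr_ge0.
  exact: dlow.
clearbody V0.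
have As0 : (V0^T *m A *m V0)^T = V0^T *m A *m V0 by rewrite !trmx_mul trmxK As mulmxA.
have [U [m [UU AE]]] := symmetric_diagonalizable As0; have UU2 := mulmx1C UU.
exists (V0 *m U), m; split.
- by rewrite trmx_mul mulmxA -(mulmxA V0) UU2 mulmx1.
- rewrite trmx_mul !mulmxA -(mulmxA (U^T)) -(mulmxA U^T) AE !mulmxA UU mul1mx.
  by rewrite -mulmxA UU mulmx1.
move=> z; rewrite qformE -mulmxA dotm_mull trmxK -mulmxA.
apply: le_trans (V0low _); rewrite dotm_mull mulmxA UU mul1mx //.
Qed.

End Factor.

(** * The gap to a low-rank optimizer *)

Section Gap.
Variables (R : realType) (n r : nat) (N : 'M[R]_n -> R).
Hypothesis Nuin : unitarily_invariant_norm N.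
Variables (X G : 'M[R]_n) (V : 'M[R]_(n, r)) (m : 'rV[R]_r) (eps lam : R).
Hypotheses (XS : spectrahedron X) (Gpsd : psd G) (eps0 : 0 <= eps) (lam0 : 0 < lam).
(* In terms of X^(1/2), the second bound says that G X^(1/2) has norm at most
   sqrt 5 eps. *)
Hypothesis GX1 : forall w : 'cV[R]_n,
  qform G (X *m w) <= 2 * eps * dotm (X *m w) (X *m w).
Hypothesis GX2 : forall w : 'cV[R]_n,
  dotm (G *m (X *m w)) (G *m (X *m w)) <= 5 * eps ^+ 2 * qform X w.
Hypothesis V1 : dotm V V = 1.
Hypothesis VXV : V^T *m X *m V = diag_mx m.
Hypothesis Vlam : forall z : 'cV[R]_r, lam * dotm z z <= qform (V^T *m V) z.

Let Xp : psd X. Proof. by case: XS. Qed.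
Let Xs : X^T = X. Proof. by case: Xp. Qed.

Let m0 i : 0 <= m 0 i.
Proof.
have := proj2 Xp (col i V); suff -> : qform X (col i V) = m 0 i by [].
have := congr1 (fun M : 'M[R]_r => M i i) VXV; rewrite [RHS]mxE eqxx mulr1n => <-.
rewrite /qform !colE mulmxA.
transitivity (((delta_mx 0 i : 'rV[R]_r) *m (V^T *m X *m V) *m (delta_mx i 0 : 'cV[R]_r)) 0 0).
  by rewrite trmx_mul trmx_delta !mulmxA.
by rewrite -rowE -colE !mxE.
Qed.

(** [U] is the factor of the Nystrom approximation of [X] along [V]: its columns
    are those of X V, normalized so that the two matrices have the same form on
    the range of [V]. Where [m] vanishes so does the column of X V, and the
    normalization 0^-1 = 0 is harmless. *)
Let D := diag_mx (\row_i (Num.sqrt (m 0 i))^-1).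
Let U := X *m V *m D.
Let E := X - U *m U^T.

Let DT : D^T = D. Proof. exact: tr_diag_mx. Qed.

Let DmD : D *m diag_mx m *m D = diag_mx (\row_i (m 0 i != 0)%:R).
Proof.
rewrite !mulmx_diag; congr diag_mx; apply/rowP => i; rewrite !mxE.
have [->|mn] := eqVneq (m 0 i) 0; first by rewrite mulr0 mul0r.
by rewrite mulrAC -invfM -expr2 sqr_sqrtr // mulVf.
Qed.

Let DmDD : D *m diag_mx m *m D *m D = D.
Proof.
rewrite DmD mulmx_diag; congr diag_mx; apply/rowP => i; rewrite !mxE.
by have [->|mn] := eqVneq (m 0 i) 0; rewrite ?sqrtr0 ?invr0 ?mulr0 // mul1r.
Qed.

Let UV : U^T *m V = diag_mx (\row_i Num.sqrt (m 0 i)).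
Proof.
rewrite /U !trmx_mul Xs DT -!mulmxA (mulmxA V^T) VXV mulmx_diag; congr diag_mx.
apply/rowP => i; rewrite !mxE.
have [->|mn] := eqVneq (m 0 i) 0; first by rewrite mulr0 sqrtr0.
by rewrite -{2}(sqr_sqrtr (m0 i)) expr2 mulKf // sqrtr_eq0 -ltNge lt_neqAle eq_sym mn m0.
Qed.

Let UV_psd : psd (U^T *m V).
Proof.
rewrite UV -[diag_mx _]mul1mx -[1%:M *m _]mulmx1 -{2}trmx1; apply: psd_diag_conj => i.
by rewrite mxE sqrtr_ge0.
Qed.

(** [T] is the projection, orthogonal for the form of [X], whose compression of
    [X] is U U^T; thus the remainder [E] is the compression by 1 - T. *)
Let T := V *m D *m D *m V^T *m X.

Let UU : U *m U^T = X *m T.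
Proof. by rewrite /U /T !trmx_mul Xs DT !mulmxA. Qed.

Let TXT : T^T *m X *m T = X *m T.
Proof.
rewrite /T !trmx_mul trmxK Xs DT -!mulmxA.
rewrite (mulmxA V^T X) (mulmxA (V^T *m X) V) VXV.
rewrite (mulmxA D (diag_mx m)) (mulmxA (D *m diag_mx m) D) (mulmxA (_ *m D) D).
by rewrite DmDD.
Qed.

Let TX : T^T *m X = X *m T.
Proof. by rewrite /T !trmx_mul trmxK Xs DT !mulmxA. Qed.

Let EE : E = (1%:M - T)^T *m X *m (1%:M - T).
Proof.
have T1 : (1%:M - T)^T = 1%:M - T^T by rewrite linearB /= trmx1.
rewrite T1 mulmxBl mul1mx !mulmxBr !mulmx1 !mulmxBl TXT TX /E UU.
by rewrite subrr subr0.
Qed.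

Let E_psd : psd E.
Proof. by rewrite EE; exact: psd_conj. Qed.

Let EX : (E^T <= X^T)%MS.
Proof.
rewrite /E UU -{1}(mulmx1 X) -mulmxBr trmx_mul; exact: submxMl.
Qed.

Let VEV : dotm V (E *m V) = 0.
Proof.
rewrite /E mulmxBl dotmBr.
have -> : dotm V (X *m V) = \tr (diag_mx m) by rewrite /dotm mulmxA VXV.
have -> : dotm V (U *m U^T *m V) = dotm (U^T *m V) (U^T *m V).
  by rewrite -mulmxA dotm_mull.
rewrite UV /dotm tr_diag_mx mulmx_diag -linearB /=.
rewrite /mxtrace big1 // => i _; rewrite !mxE eqxx !mulr1n.
by rewrite -expr2 sqr_sqrtr // subrr.
Qed.

Let H := U - V.

(** A projection [Q] that fixes [U] and [V] changes X - V V^T into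
    U U^T - V V^T plus Q E Q. That term is positive semidefinite and orthogonal to
    V V^T, so it can only increase the distance. The compression by [Q] brings
    the rank down to 2 r, where [kappa] applies, and does not increase [N]. *)
Lemma factor_distance :
  2 * (Num.sqrt 2 - 1) * lam * dotm H H <=
  kappa N r ^+ 2 * N (X - V *m V^T) ^+ 2.
Proof.
apply: le_trans (procrustes UV_psd Vlam) _; set Y := _ - _.
have [Q [Qs QQ QV QXV Qr]] := range_projection V (X *m V).
have QU : Q *m U = U by rewrite /U !mulmxA -(mulmxA Q) QXV.
set Z := X - V *m V^T.
have projE (C : 'M[R]_(n, r)) : Q *m C = C -> Q *m (C *m C^T) *m Q = C *m C^T.
  by move=> QC; rewrite mulmxA QC -mulmxA -{1}Qs -trmx_mul QC.
pose F := Q *m E *m Q.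
have ZE : Q *m Z *m Q = Y + F.
  rewrite /F /E /Z !mulmxBr !mulmxBl !projE // /Y.
  by rewrite [RHS]addrC addrA subrK.
have YF : 0 <= dotm Y F.
  rewrite /Y dotmBl.
  have -> : dotm (V *m V^T) F = 0.
    rewrite dotmC dotm_mulr trmxK /F -!mulmxA QV dotmC dotm_mull Qs QV.
    exact: VEV.
  rewrite subr0 dotmC dotm_mulr trmxK dotmC; apply: psd_dotm_ge0.
  by rewrite /F -{1}Qs; exact: psd_conj.
have fZ : frobenius (Q *m Z *m Q) <= `|kappa N r| * N Z.
  apply: (@le_trans _ _ (`|kappa N r| * N (Q *m Z *m Q))).
    apply: (@le_trans _ _ (kappa N r * N (Q *m Z *m Q))); last first.
      by rewrite ler_wpM2r ?(uin_ge0 Nuin) // ler_norm.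
    apply: (frobenius_le_kappa Nuin).
      by rewrite !trmx_mul Qs /Z linearB /= trmx_mul trmxK Xs mulmxA.
    by apply: leq_trans (mxrankM_maxr _ _) _.
  rewrite ler_wpM2l //; apply: le_trans (uin_mul_proj Nuin _ Qs QQ) _.
  exact: (uin_proj_mul Nuin _ Qs QQ).
have : frobenius (Q *m Z *m Q) ^+ 2 <= (`|kappa N r| * N Z) ^+ 2.
  by rewrite ler_pXn2r ?nnegrE ?frobenius_ge0 ?mulr_ge0 ?(uin_ge0 Nuin).
rewrite exprMn real_normK ?num_real //; apply: le_trans.
rewrite frobenius_sqr ZE (dotm_sqrD Y F).
have := dotm_ge0 F; lra.
Qed.

(** Since tr X = |V|^2 = 1, the trace of the remainder is |V|^2 - |U|^2, which is
    at most 2 |U - V|. *)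
Lemma tail_le : inner G E <= 4 * eps * Num.sqrt (dotm H H).
Proof.
apply: le_trans (inner_psd_le E_psd EX GX1) _.
suff : \tr E <= 2 * Num.sqrt (dotm H H).
  move=> h; have : 2 * eps * \tr E <= 2 * eps * (2 * Num.sqrt (dotm H H)).
    by rewrite ler_wpM2l // mulr_ge0.
  lra.
have -> : \tr E = dotm V V - dotm U U.
  by rewrite /E linearB /= (proj2 XS) V1 dotm_outer.
have h1 := dotm_ge0 H.
have h2 : dotm H H = dotm U U - 2 * dotm U V + dotm V V.
  rewrite /H dotmBl !dotmBr (dotmC V U); ring.
have h3 : dotm V V - dotm U U <= 2 * dotm V (- H).
  by rewrite dotmNr /H dotmBr (dotmC V U); lra.
apply: le_trans h3 _; rewrite ler_pM2l //; apply: le_trans (ler_norm _) _.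
rewrite -sqrtr_sqr; apply: ler_wsqrtr; apply: le_trans (dotm_CS _ _) _.
by rewrite V1 mul1r dotmNl dotmNr opprK.
Qed.

(** The columns of [U] have pseudoinverse form 1, or vanish. *)
Lemma GU_le : dotm (G *m U) (G *m U) <= 5 * eps ^+ 2 * r%:R.
Proof.
rewrite dotm_cols1.
apply: (@le_trans _ _ (\sum_j 5 * eps ^+ 2 * qform X (col j (V *m D)))).
  apply: ler_sum => j _.
  have -> : col j (G *m U) = G *m (X *m col j (V *m D)).
    by rewrite /U !colE !mulmxA.
  exact: GX2.
rewrite -mulr_sumr -dotm_cols; apply: ler_wpM2l; first by rewrite mulr_ge0 // sqr_ge0.
have -> : dotm (V *m D) (X *m (V *m D)) = \tr (D *m diag_mx m *m D).
  by rewrite /dotm trmx_mul DT -VXV !mulmxA.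
rewrite DmD mxtrace_diag; apply: (@le_trans _ _ (\sum_(i < r) 1)).
  by apply: ler_sum => i _; rewrite mxE; case: (_ != _).
by rewrite sumr_const card_ord.
Qed.

(** Split X - V V^T into the remainder and U U^T - V V^T. Convexity of the form
    of [G] bounds the second part by 2 <U - V, G U>. *)
Lemma inner_gap_sqr : (0 < r)%N -> 0 <= inner G (X - V *m V^T) ->
  inner G (X - V *m V^T) ^+ 2 <= 72 * r%:R * eps ^+ 2 * dotm H H.
Proof.
move=> r0 g0; set h := Num.sqrt (dotm H H).
pose k := Num.sqrt (dotm (G *m U) (G *m U)).
have h2 : h ^+ 2 = dotm H H by rewrite sqr_sqrtr // dotm_ge0.
have k2 : k ^+ 2 <= 5 * eps ^+ 2 * r%:R by rewrite sqr_sqrtr ?dotm_ge0 //; exact: GU_le.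
have h0 : 0 <= h by exact: sqrtr_ge0.
have k0 : 0 <= k by exact: sqrtr_ge0.
have low : inner G (U *m U^T - V *m V^T) <= 2 * (h * k).
  have inn (C : 'M[R]_(n, r)) : inner G (C *m C^T) = dotm C (G *m C).
    by rewrite /inner mulmxA mxtrace_mulC.
  rewrite innerBr !inn.
  have p0 := psd_dotm_ge0 H Gpsd.
  have sy : dotm V (G *m U) = dotm U (G *m V) by rewrite dotm_mull (proj1 Gpsd) dotmC.
  have e1 : dotm H (G *m H) = dotm U (G *m U) - 2 * dotm V (G *m U) + dotm V (G *m V).
    by rewrite /H mulmxBr dotmBl !dotmBr sy; ring.
  apply: (@le_trans _ _ (2 * dotm H (G *m U))).
    by rewrite /H dotmBl; lra.
  rewrite ler_pM2l //; apply: le_trans (ler_norm _) _.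
  rewrite -sqrtr_sqr /h /k -sqrtrM ?dotm_ge0 //; apply: ler_wsqrtr.
  exact: dotm_CS.
have tot : inner G (X - V *m V^T) <= 4 * eps * h + 2 * (h * k).
  have -> : X - V *m V^T = E + (U *m U^T - V *m V^T) by rewrite addrA subrK.
  by rewrite innerDr; apply: lerD => //; exact: tail_le.
have sq : inner G (X - V *m V^T) ^+ 2 <= (4 * eps * h + 2 * (h * k)) ^+ 2.
  by rewrite ler_pXn2r ?nnegrE // (le_trans g0).
apply: le_trans sq _; rewrite -h2.
have s1 := sqr_ge0 (4 * eps * h - 2 * (h * k)).
have s2 : h ^+ 2 * k ^+ 2 <= h ^+ 2 * (5 * eps ^+ 2 * r%:R).
  by rewrite ler_wpM2l // sqr_ge0.
have s3 : h ^+ 2 * eps ^+ 2 * 1 <= h ^+ 2 * eps ^+ 2 * r%:R.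
  by rewrite ler_wpM2l ?ler1n // mulr_ge0 ?sqr_ge0.
lra.
Qed.

Lemma inner_gap : (0 < r)%N -> 0 <= inner G (X - V *m V^T) ->
  (Num.sqrt 2 - 1) * lam * inner G (X - V *m V^T) ^+ 2 <=
  36 * r%:R * eps ^+ 2 * (kappa N r ^+ 2 * N (X - V *m V^T) ^+ 2).
Proof.
move=> r0 g0; have h1 := inner_gap_sqr r0 g0; have h2 := factor_distance.
have s1 : 1 <= Num.sqrt 2 :> R by rewrite -[leLHS]sqrtr1; apply: ler_wsqrtr; rewrite ler1n.
have sl : 0 <= (Num.sqrt 2 - 1) * lam by rewrite mulr_ge0 ?subr_ge0 // ltW.
have h3 := ler_wpM2l sl h1.
have c0 : 0 <= 36 * r%:R * eps ^+ 2 by rewrite !mulr_ge0 ?sqr_ge0.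
have := ler_wpM2l c0 h2; lra.
Qed.

End Gap.

(** * Backtracking *)

Section Armijo.
Variables (R : realType) (n : nat) (f : 'M[R]_n -> R).
Implicit Types (X : 'M[R]_n) (path : R -> 'M[R]_n).

Lemma step_sizes_bounds (th : R) : step_sizes th -> 0 <= th <= 1.
Proof.
case=> [->|[j ->]]; first by rewrite lexx ler01.
by rewrite invr_ge0 exprn_ge0 //= invf_le1 ?exprn_gt0 // exprn_ege1 // ler1n.
Qed.

(** The step sizes accumulate only at 0, which is admissible. *)
Lemma armijo_max X path (delta : R) : path 0 = X ->
  let th := armijo f X path delta in
  [/\ step_sizes th, f (path th) <= f X - th * delta &
      forall th', step_sizes th' -> f (path th') <= f X - th' * delta -> th' <= th].
Proof.
move=> p0; rewrite /armijo.
set A := [set th | step_sizes th /\ _].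
have A0 : A 0 by split; [left | rewrite p0 mul0r subr0].
have [th [thA thU]] : exists th, (A `&` ubound A) th.
  have [[j Aj]|nA] := pselect (exists j : nat, A (2 ^- j)).
    have /ex_minnP[k /asboolP Ak kmin] : exists j, `[< A (2 ^- j) >].
      by exists j; apply/asboolP.
    exists (2 ^- k); split => // th [[->|[i ->]] fi].
      by rewrite invr_ge0 exprn_ge0.
    rewrite lef_pV2 ?posrE ?exprn_gt0 // ler_eXn2l ?ltr1n //.
    by apply: kmin; apply/asboolP; split => //; right; exists i.
  exists 0; split => // th [[->//|[i thi]] fi].
  by case: nA; exists i; rewrite -thi; split => //; right; exists i.
have [[h1 h2] h3] := @xgetPex _ 0 (A `&` ubound A) (ex_intro _ th (conj thA thU)).
by split => // th' s' f'; apply: h3.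
Qed.

(** The first step size below the threshold c / K is within a factor two of it,
    and the search stops there at the latest. *)
Lemma armijo_large X path (delta K c : R) : path 0 = X -> 0 <= c ->
  (forall th, 0 < th -> th <= 1 -> K * th <= c ->
     f (path th) <= f X - th * delta) ->
  let th := armijo f X path delta in th = 1 \/ c < K /\ c / 2 <= K * th.
Proof.
move=> p0 c0 acc th; have [thS thf thmax] := armijo_max delta p0.
rewrite -/th in thS thf thmax.
have /andP[th0 th1] := step_sizes_bounds thS.
have [Kc|cK] := leP K c.
  left; apply/eqP; rewrite eq_le th1; apply: thmax.
    by right; exists 0%N; rewrite expr0 invr1.
  by apply: acc; rewrite ?mulr1.
right; split => //; have K0 : 0 < K by apply: le_lt_trans cK.
have [->|cn] := eqVneq c 0; first by rewrite mul0r mulr_ge0 // ltW.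
have cp : 0 < c by rewrite lt_neqAle eq_sym cn.
have ex : exists j : nat, K / 2 ^+ j <= c.
  exists (Num.bound (K / c)); rewrite ler_pdivrMr ?exprn_gt0 //.
  rewrite mulrC -ler_pdivrMr //.
  apply: le_trans (ltW (archi_boundP _)) _; first by rewrite divr_ge0 // ltW.
  by rewrite -natrX ler_nat ltnW // ltn_expl.
have [j jP jmin] := ex_minnP ex.
case: j jP jmin => [|j] jP jmin.
  by move: jP; rewrite expr0 invr1 mulr1 leNgt cK.
have : ~~ (K / 2 ^+ j <= c) by apply/negP => /jmin; rewrite ltnn.
rewrite -ltNge => h.
apply: (@le_trans _ _ (K * 2 ^- j.+1)).
  rewrite exprS invfM mulrCA mulrC; apply: ler_wpM2l; first by rewrite invr_ge0.
  exact: ltW.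
rewrite ler_pM2l //; apply: thmax; first by right; exists j.+1.
have p0' : 0 < 2 ^- j.+1 :> R by rewrite invr_gt0 exprn_gt0.
apply: acc => //.
by rewrite invf_le1 ?exprn_gt0 // exprn_ege1 // ler1n.
Qed.

End Armijo.

(** * Rotating a unit vector *)

Section Rotation.
Variables (R : realType) (n : nat) (u p : 'cV[R]_n).
Hypotheses (u1 : dotm u u = 1) (p1 : dotm p p = 1) (up0 : dotm u p = 0).

(** The curve [pair_v], for an arbitrary direction [p]. *)
Definition rotated (th : R) : 'cV[R]_n :=
  (Num.sqrt (1 + th ^+ 2))^-1 *: (u - th *: p).

Lemma one_plus_sqr_gt0 (th : R) : 0 < 1 + th ^+ 2.
Proof. by rewrite ltr_pwDl // sqr_ge0. Qed.

Lemma rotated1 (th : R) : dotm (rotated th) (rotated th) = 1.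
Proof.
have th2 := one_plus_sqr_gt0 th.
rewrite dotmZl dotmZr mulrA -invfM -expr2 sqr_sqrtr ?(ltW th2) //.
rewrite dotmBl !dotmBr !dotmZl !dotmZr u1 p1 (dotmC p) up0.
by field; rewrite gt_eqF.
Qed.

Lemma rotated_outer (th : R) : rotated th *m (rotated th)^T - u *m u^T =
  (1 + th ^+ 2)^-1 *: (th ^+ 2 *: (p *m p^T - u *m u^T) -
                       th *: (u *m p^T + p *m u^T)).
Proof.
have th2 := one_plus_sqr_gt0 th.
have e i : rotated th i 0 * (Num.sqrt (1 + th ^+ 2)) = u i 0 - th * p i 0.
  by rewrite !mxE mulrAC mulVf ?mul1r // sqrtr_eq0 -ltNge.
have e2 i j : rotated th i 0 * rotated th j 0 * (1 + th ^+ 2) =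
    (u i 0 - th * p i 0) * (u j 0 - th * p j 0).
  by rewrite -!e -{1}(sqr_sqrtr (ltW th2)); ring.
apply/matrixP => i j; rewrite !mxE !big_ord1 ![_^T _ _]mxE.
have -> : rotated th i 0 * rotated th j 0 =
    (u i 0 - th * p i 0) * (u j 0 - th * p j 0) / (1 + th ^+ 2).
  by rewrite -e2 mulfK // gt_eqF.
by field; rewrite gt_eqF.
Qed.

(** The mixed term is a difference of two projections, onto the bisectors of
    [u] and [p]; so it is no longer than a diameter. *)
Lemma uin_mixed_le_diameter (N : 'M[R]_n -> R) : unitarily_invariant_norm N ->
  N (u *m p^T + p *m u^T) <= diameter N.
Proof.
move=> Nuin; pose r2 : R := (Num.sqrt 2)^-1.
have r22 : r2 * r2 = 2^-1 by rewrite -invfM -expr2 sqr_sqrtr.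
have x1 : dotm (r2 *: (u + p)) (r2 *: (u + p)) = 1.
  by rewrite dotmZl dotmZr mulrA r22 dotmDl !dotmDr u1 p1 (dotmC p) up0; lra.
have y1 : dotm (r2 *: (u - p)) (r2 *: (u - p)) = 1.
  by rewrite dotmZl dotmZr mulrA r22 dotmBl !dotmBr u1 p1 (dotmC p) up0; lra.
have := uin_le_diameter Nuin (spectrahedron_outer x1) (spectrahedron_outer y1).
congr (N _ <= _); apply/matrixP => i j; rewrite !mxE !big_ord1 !mxE.
transitivity (r2 * r2 * 2 * (u i 0 * p j 0 + p i 0 * u j 0)); first by ring.
by rewrite r22; field.
Qed.

Lemma uin_rotated_le (N : 'M[R]_n -> R) (th : R) : unitarily_invariant_norm N ->
  0 <= th -> N (rotated th *m (rotated th)^T - u *m u^T) <=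
             (th ^+ 2 + th) / (1 + th ^+ 2) * diameter N.
Proof.
move=> Nuin th0; have th2 := one_plus_sqr_gt0 th.
rewrite rotated_outer (uin_scale Nuin) ger0_norm ?invr_ge0 ?(ltW th2) //.
rewrite mulrAC mulrC ler_pM2r ?invr_gt0 // mulrDl.
apply: le_trans (uin_triangle Nuin _ _) _; rewrite (uin_opp Nuin) !(uin_scale Nuin).
rewrite !ger0_norm ?sqr_ge0 //; apply: lerD; apply: ler_wpM2l; rewrite ?sqr_ge0 //.
  by apply: (uin_le_diameter Nuin); exact: spectrahedron_outer.
exact: uin_mixed_le_diameter.
Qed.

Lemma inner_rotated (A : 'M[R]_n) (th : R) : A^T = A ->
  inner A (rotated th *m (rotated th)^T - u *m u^T) =
  (th ^+ 2 * (qform A p - qform A u) - 2 * th * dotm p (A *m u)) / (1 + th ^+ 2).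
Proof.
move=> As; rewrite rotated_outer innerZr innerBr !innerZr innerBr innerDr !inner_outer.
have -> : inner A (u *m p^T) = dotm p (A *m u).
  by rewrite /inner mulmxA mxtrace_mulC.
have -> : inner A (p *m u^T) = dotm p (A *m u).
  by rewrite /inner mulmxA mxtrace_mulC -/(dotm u _) dotm_mull As dotmC.
ring.
Qed.

End Rotation.

(** * One iteration *)

(** The gap [h] is at most [g] and [N2] is of order [h], so one factor [h] can be
    cancelled; 1152 is 36 * 8 * 4. *)
Lemma rate_of_gap (R : realType) (c t alpha lam h r K D k2 N2 g : R) :
  1152 <= c ->
  0 < alpha -> 0 <= t -> 0 <= lam -> 0 < h -> 0 <= r -> 0 <= K -> 0 <= D ->
  0 <= k2 -> h <= g -> N2 <= 4 / alpha * h ->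
  t * lam * g ^+ 2 <= 36 * r * (8 * K * D) * (k2 * N2) ->
  t * alpha * lam / (c * r * k2 * K) * h <= D.
Proof.
move=> c1152 alpha0 t0 lam0 h0 r0 K0 D0 k20 hg N2h main.
have c0 : 0 <= c by exact: le_trans (ler0n R 1152) c1152.
set den := c * r * k2 * K.
have den0 : 0 <= den by rewrite !mulr_ge0.
have [denz|denn] := eqVneq den 0; first by rewrite denz invr0 mulr0 mul0r.
have denp : 0 < den by rewrite lt_neqAle eq_sym denn.
rewrite mulrAC ler_pdivrMr // -(ler_pM2r h0).
have m1 : t * lam * h ^+ 2 <= t * lam * g ^+ 2.
  apply: ler_wpM2l; first exact: mulr_ge0.
  by rewrite ler_pXn2r ?nnegrE ?(ltW h0) // (le_trans (ltW h0)).
have m2 : 0 <= 36 * r * (8 * K * D) * k2 by do 4 (apply: mulr_ge0 => //).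
have m3 := ler_wpM2l m2 N2h.
have m4 : alpha * (t * lam * h ^+ 2) <=
          alpha * (36 * r * (8 * K * D) * k2 * (4 / alpha * h)).
  rewrite ler_pM2l //; apply: le_trans m1 _; apply: le_trans main _.
  by rewrite mulrA.
have m5 : alpha * (36 * r * (8 * K * D) * k2 * (4 / alpha * h)) =
          1152 * (r * K * D * k2 * h).
  by field; rewrite gt_eqF.
have m6 : 0 <= r * K * D * k2 * h by rewrite !mulr_ge0 // ltW.
have m7 : 1152 * (r * K * D * k2 * h) <= c * (r * K * D * k2 * h).
  by rewrite ler_wpM2r.
rewrite m5 in m4; rewrite [leLHS](_ : _ = alpha * (t * lam * h ^+ 2)); last by ring.
by rewrite [leRHS](_ : _ = c * (r * K * D * k2 * h)) ?(le_trans m4 m7) // /den; ring.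
Qed.

Section Step.
Variables (R : realType) (n : nat) (N f : 'M[R]_n -> R).
Variables (grad : 'M[R]_n -> 'M[R]_n) (beta : R).
Hypothesis Nuin : unitarily_invariant_norm N.
Hypothesis f_convex : convex_function (@spectrahedron R n) f.
Hypothesis f_grad :
  forall Y : 'M[R]_n, spectrahedron Y -> is_gradient f Y (grad Y).
Hypothesis f_smooth : smooth N beta grad.

Variables (X : 'M[R]_n) (d : directions R n).
Hypothesis XS : spectrahedron X.
Hypothesis dvalid : valid_directions X (grad X) d.

Let G := grad X.
Let Gs := shifted_grad G.
Let g := inner Gs X.
Let vp := fw_dir d.
Let vm := away_dir d.
Let u := pair_dir d.
Let Xs : X^T = X. Proof. exact: spectrahedron_sym XS. Qed.
Let Gsym : G^T = G. Proof. exact: (grad_sym f_grad XS). Qed.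
Let Gpsd : psd Gs. Proof. exact: psd_shifted_grad. Qed.
Let M := beta * diameter N ^+ 2.
Let Gt := Gtilde grad.

Let vp1 : dotm vp vp = 1. Proof. by case: dvalid => -[/norm2_eq1]. Qed.
Let vm_max : argmax (unit_image X) (qform Gs) vm. Proof. by case: dvalid. Qed.
Let u_max : argmax (unit_image X)
  (fun w => qform (Gs *m Gs) w / qform (mp_inverse X) w) u.
Proof. by case: dvalid. Qed.
Let vm1 : dotm vm vm = 1. Proof. by case: vm_max => /(unit_imageP Xs)[]. Qed.
Let u1 : dotm u u = 1. Proof. by case: u_max => /(unit_imageP Xs)[]. Qed.
Let M0 : 0 <= M. Proof. exact: (smooth_diameter_ge0 Nuin f_grad f_smooth XS). Qed.

Lemma gap_ge0 : 0 <= g.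
Proof. by apply: inner_psd_ge0 => //; case: XS. Qed.

Lemma Gt_dot (v : 'cV[R]_n) : dotm v v = 1 -> dotm (Gs *m v) (Gs *m v) <= Gt ^+ 2.
Proof.
move=> v1; rewrite -norm2_sqr ler_pXn2r ?nnegrE ?norm2_ge0 //.
  by apply: (Gtilde_ge Nuin f_grad f_smooth XS); exact: norm2_dot1.
exact: (Gtilde_ge0 Nuin f_grad f_smooth XS (norm2_dot1 v1)).
Qed.

Lemma Gt_ge0 : 0 <= Gt.
Proof. exact: (Gtilde_ge0 Nuin f_grad f_smooth XS (norm2_dot1 vp1)). Qed.

Lemma Gt_qform (v : 'cV[R]_n) : dotm v v = 1 -> qform Gs v <= Gt.
Proof.
move=> v1; have := dotm_CS v (Gs *m v); rewrite v1 mul1r -qformE => h.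
have := le_trans h (Gt_dot v1); rewrite ler_pXn2r ?nnegrE ?Gt_ge0 //.
by apply: (proj2 Gpsd).
Qed.

(** Maximality of the away direction among unit vectors, extended to the whole
    range by homogeneity. *)
Lemma away_dir_max (w : 'cV[R]_n) :
  qform Gs (X *m w) <= qform Gs vm * dotm (X *m w) (X *m w).
Proof.
set v := X *m w; have [v0|vn] := eqVneq v 0.
  by rewrite v0 qformE mulmx0 !dotm0l mulr0.
have [c c0 cv1] := unit_multiple vn.
have iv : unit_image X (c *: v).
  split; last exact: norm2_dot1.
  by rewrite linearZ /= scalemx_sub // /v trmx_mul submxMl.
have [_ /(_ _ iv)] := vm_max; rewrite qform_scale => h.
have c2 : 0 < c ^+ 2 by rewrite exprn_gt0.
move: cv1; rewrite dotmZl dotmZr mulrA -expr2 => cv1.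
by rewrite -(ler_pM2l c2) mulrCA cv1 mulr1.
Qed.

Lemma gap_le_away : g <= qform Gs vm.
Proof.
rewrite -[leRHS]mulr1 -(proj2 XS); apply: inner_psd_le => //.
  by case: XS.
exact: away_dir_max.
Qed.

Lemma descent_shifted Z : spectrahedron Z ->
  f Z <= f X + inner Gs (Z - X) + beta / 2 * N (Z - X) ^+ 2.
Proof.
move=> ZS; rewrite inner_shifted //.
exact: (descent Nuin f_convex f_grad f_smooth XS ZS).
Qed.

Lemma descent_line A B (t : R) : spectrahedron A -> spectrahedron B ->
  spectrahedron (X + t *: (A - B)) ->
  f (X + t *: (A - B)) <= f X + t * inner Gs (A - B) + t ^+ 2 * (M / 2).
Proof.
move=> AS BS ZS; apply: le_trans (descent_shifted ZS) _.
have -> : X + t *: (A - B) - X = t *: (A - B) by rewrite addrAC subrr add0r.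
rewrite innerZr lerD2l (uin_scale Nuin) exprMn.
rewrite -normrX ger0_norm ?sqr_ge0 //.
rewrite [leLHS](_ : _ = t ^+ 2 * (beta * N (A - B) ^+ 2 / 2)); last by ring.
apply: ler_wpM2l; first exact: sqr_ge0.
rewrite ler_pM2r ?invr_gt0 //.
exact: (smooth_le_diameter Nuin f_grad f_smooth AS BS).
Qed.

(** * Frank-Wolfe steps *)

Lemma fw_path_spectrahedron (th : R) : 0 <= th <= 1 -> spectrahedron (fw_path X d th).
Proof. by move=> th01; apply: spectrahedron_conv => //; exact: spectrahedron_outer. Qed.

Lemma fw_path_le (th : R) : 0 <= th <= 1 ->
  f (fw_path X d th) <= f X - th * g + th ^+ 2 * (M / 2).
Proof.
move=> th01; apply: le_trans (descent_line _ _ _) _ => //.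
- exact: spectrahedron_outer.
- exact: fw_path_spectrahedron.
rewrite innerBr inner_outer -/g (_ : qform Gs vp = 0) ?sub0r ?mulrN //.
case: dvalid => -[_ Gv] _ _.
by rewrite qformE /Gs /shifted_grad mulmxBl Gv mul_scalar_mx subrr dotm0r.
Qed.

(** A full step gives the first alternative, a shortened one the second. *)
Lemma fw_progress : let Y := fw_point f X G d in
  [/\ spectrahedron Y, f Y <= f X &
    (f Y <= f X - g / 2 /\ f Y <= f X - g + M / 2) \/
    (g <= M /\ g ^+ 2 <= 4 * M * (f X - f Y))].
Proof.
move=> Y; pose th := armijo f X (fw_path X d) (2^-1 * g).
have p0 : fw_path X d 0 = X by rewrite /fw_path scale0r addr0.
have [thS thf0 _] := armijo_max f (2^-1 * g) p0; rewrite -/th in thS thf0.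
have thf : f Y <= f X - th * (2^-1 * g) by [].
have th01 := step_sizes_bounds thS; have /andP[th0 th1] := th01.
have g0 := gap_ge0.
split; first exact: fw_path_spectrahedron.
  by apply: le_trans thf _; rewrite gerBl mulr_ge0 // mulr_ge0 // invr_ge0.
have := @armijo_large _ _ f X (fw_path X d) (2^-1 * g) (M / 2) (2^-1 * g) p0.
rewrite -/th /= => -[].
- by rewrite mulr_ge0 // invr_ge0.
- move=> t t0 t1 Kt; apply: le_trans (fw_path_le _) _; first by rewrite (ltW t0).
  have : t * (M / 2 * t) <= t * (2^-1 * g) by rewrite ler_pM2l.
  lra.
- move=> e1; left; split; first by move: thf; rewrite e1; lra.
  have := @fw_path_le 1; rewrite lexx ler01 => /(_ erefl).
  rewrite [fw_path X d 1](_ : _ = Y); first lra.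
  by rewrite -e1.
- move=> [cK cth]; right; split; first by lra.
  have gth : g / 2 <= M * th by lra.
  have : g * (g / 2) <= g * (M * th) by rewrite ler_wpM2l.
  have : M * (th * (2^-1 * g)) <= M * (f X - f Y).
    by apply: ler_wpM2l => //; lra.
  lra.
Qed.


(** * Away steps *)

Let q := qform (mp_inverse X) vm.
Let s := away_scale X d.
Let b := qform Gs vm - g.

Let q1 : 1 <= q.
Proof. by apply: mp_ge1 => //; case: vm_max. Qed.

Let b0 : 0 <= b.
Proof. by rewrite subr_ge0 gap_le_away. Qed.

Let s0 : 0 <= s.
Proof. by rewrite invr_ge0 subr_ge0. Qed.

(** Either the slope already vanishes, or [X] is the rank-one matrix of the away
    direction. *)
Lemma away_degenerate_gap : away_degenerate X G d -> b = 0.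
Proof.
move=> deg; have [im_vm _] := vm_max; apply/eqP; apply: contraT => bn.
have XE : X = vm *m vm^T.
  apply: spectrahedron_outer_eq => //; apply/orP.
  case/orP: deg => [r1|]; [by right | rewrite !mulf_eq0 => /orP[/orP[|]|]].
  - by rewrite invr_eq0 pnatr_eq0.
  - by rewrite invr_eq0 subr_eq0; left.
  - by move=> h; move: bn; rewrite (eqP (h : b == 0)) eqxx.
by move: bn; rewrite /b /g [X in inner _ X]XE inner_outer subrr eqxx.
Qed.

Lemma away_path0 : away_path X G d 0 = X.
Proof. by rewrite /away_path; case: ifP => // _; rewrite mul0r scale0r addr0. Qed.

Lemma away_path_spectrahedron (th : R) : 0 <= th <= 1 ->
  spectrahedron (away_path X G d th).
Proof.
move=> /andP[th0 th1]; rewrite /away_path; case: ifP => // _.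
have [im_vm _] := vm_max.
apply: spectrahedron_away => //; first by rewrite mulr_ge0.
rewrite -/q -mulrA; apply: mulr_ile1 => //; first by rewrite mulr_ge0 // subr_ge0.
have [->|qn] := eqVneq q 1; first by rewrite subrr mulr0.
by rewrite mulVf // subr_eq0.
Qed.

Lemma away_slopeE : away_slope X G d = 2^-1 * s * b.
Proof. by []. Qed.

Lemma away_path_le (th : R) : ~~ away_degenerate X G d -> 0 <= th <= 1 ->
  f (away_path X G d th) <= f X - th * s * b + (th * s) ^+ 2 * (M / 2).
Proof.
move=> ndeg th01; have ZS := away_path_spectrahedron th01.
move: ZS; rewrite /away_path (negPf ndeg) => ZS.
apply: le_trans (descent_line _ _ ZS) _ => //; first exact: spectrahedron_outer.
by rewrite innerBr inner_outer -/g -/vm -/s -opprB -/b mulrN.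
Qed.

Lemma away_armijo : let Y := away_point f X G d in
  let th := away_theta f X G d in
  [/\ spectrahedron Y, f Y <= f X, 0 <= th & th <= 1].
Proof.
move=> Y th.
have thS : 0 <= th <= 1 /\ f Y <= f X.
  rewrite /Y /th /away_point /away_theta; case: ifP => deg.
    by rewrite away_path0 !lexx ler01.
  have [thS thf _] := armijo_max f (away_delta X G d) away_path0.
  have th01 := step_sizes_bounds thS; split => //.
  apply: le_trans thf _; rewrite gerBl mulr_ge0 //; first by case/andP: th01.
  by rewrite /away_delta deg away_slopeE !mulr_ge0 // invr_ge0.
case: thS => th01 fY; split => //; try by case/andP: th01.
exact: away_path_spectrahedron.
Qed.

Lemma away_rank : (\rank (away_point f X G d) <= \rank X)%N.
Proof.
rewrite /away_point /away_path; case: ifP => // _.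
by apply: rank_away => //; case: vm_max.
Qed.

Lemma away_drop_rank : is_drop f X G d ->
  (\rank (away_point f X G d) < \rank X)%N.
Proof.
rewrite /is_drop /away_point => /eqP th1; rewrite th1 /away_path.
have ndeg : ~~ away_degenerate X G d.
  apply: contraPN th1 => deg; rewrite /away_theta deg.
  by move/eqP; rewrite eq_sym oner_eq0.
rewrite (negPf ndeg) mul1r; apply: rank_away_drop => //; first by case: vm_max.
rewrite lt_neqAle q1 andbT eq_sym; apply: contraNneq ndeg => qe.
by rewrite /away_degenerate /away_slope /away_scale qe subrr invr0 mulr0 mul0r eqxx orbT.
Qed.

(** The scale [s], which may be tiny when [X] has small eigenvalues, cancels: a step
    that is not a drop was shortened until M s th was of order [b], and its gain
    is of order th s b. *)
Lemma away_progress : ~~ is_drop f X G d ->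
  b ^+ 2 <= 4 * M * (f X - f (away_point f X G d)).
Proof.
have [deg _|ndeg] := boolP (away_degenerate X G d).
  rewrite away_degenerate_gap // expr0n /=; apply: mulr_ge0.
    exact: mulr_ge0.
  by rewrite subr_ge0; case: away_armijo.
rewrite /is_drop /away_point /away_theta (negPf ndeg).
set th := armijo _ _ _ _ => thn1; set Y := away_path _ _ _ _.
have [thS thf _] := armijo_max f (away_delta X G d) away_path0.
rewrite -/th -/Y in thS thf; have /andP[th0 th1] := step_sizes_bounds thS.
move: thf; rewrite /away_delta (negPf ndeg) away_slopeE => thf.
have := @armijo_large _ _ f X (away_path X G d) (away_delta X G d) (M * s) b away_path0 b0.
rewrite -/th /= => -[].
- move=> t t0 t1 Kt.
  apply: le_trans (away_path_le ndeg _) _; first by rewrite (ltW t0).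
  rewrite /away_delta (negPf ndeg) away_slopeE.
  have : t * s * (M * s * t) <= t * s * b.
    by rewrite ler_wpM2l // mulr_ge0 // ltW.
  lra.
- by move=> e1; move: thn1; rewrite e1 eqxx.
- move=> [_ h].
  have h1 : b * (b / 2) <= b * (M * s * th) by rewrite ler_wpM2l.
  have : M * (th * (2^-1 * s * b)) <= M * (f X - f Y).
    by apply: ler_wpM2l => //; lra.
  lra.
Qed.


(** * Pairwise steps *)

Let qu := qform (mp_inverse X) u.
Let gam := pair_weight X d.
Let res := pair_residual G d.
Let rho := norm2 res.
Let p := pair_p G d.

Let qu1 : 1 <= qu.
Proof. by apply: mp_ge1 => //; case: u_max. Qed.

Let qu0 : 0 < qu.
Proof. by apply: lt_le_trans qu1. Qed.

Let gam0 : 0 < gam.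
Proof. by rewrite invr_gt0. Qed.

Let gam1 : gam <= 1.
Proof. by rewrite invf_le1. Qed.

Let resE : res = Gs *m u - qform Gs u *: u.
Proof.
rewrite /res /pair_residual -/u -/Gs mulmxBl mulmxBl mul1mx.
by rewrite -!mulmxA trmx_mul_dot -qformE mul_mx_scalar.
Qed.

Let u_res : dotm u res = 0.
Proof. by rewrite resE dotmBr dotmZr u1 mulr1 -qformE subrr. Qed.

Let rho_sqr : rho ^+ 2 = dotm (Gs *m u) (Gs *m u) - qform Gs u ^+ 2.
Proof.
rewrite norm2_sqr resE dotmBl !dotmBr !dotmZl !dotmZr u1 (dotmC (Gs *m u) u).
rewrite -qformE; ring.
Qed.

Lemma coef_cE : coef_c X G d = gam * rho ^+ 2.
Proof.
rewrite rho_sqr /coef_c -/Gs -/u -/qu mulrC; congr (_ * (_ - _)).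
by rewrite qformE -mulmxA dotm_mull (proj1 Gpsd).
Qed.

Let rho_ge0 : 0 <= rho. Proof. exact: norm2_ge0. Qed.

Let rho_le : rho <= Gt.
Proof.
rewrite -(ler_pXn2r (n := 2)) ?nnegrE ?Gt_ge0 //; apply: le_trans (Gt_dot u1).
by rewrite rho_sqr gerBl sqr_ge0.
Qed.

Section Nondegenerate.
Hypothesis res0 : res != 0.

Let rho_gt0 : 0 < rho.
Proof.
rewrite lt_neqAle rho_ge0 andbT eq_sym; apply: contra_neq res0 => r0.
by apply: dotm_eq0; rewrite -norm2_sqr -/rho r0 expr0n.
Qed.

Let p1 : dotm p p = 1.
Proof.
by rewrite dotmZl dotmZr -norm2_sqr -/rho expr2 mulKf ?mulVf // gt_eqF.
Qed.

Let up0 : dotm u p = 0.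
Proof. by rewrite dotmZr u_res mulr0. Qed.

Let pGu : dotm p (Gs *m u) = rho.
Proof.
have -> : Gs *m u = res + qform Gs u *: u by rewrite resE subrK.
rewrite dotmDr dotmZr dotmC (dotmC p) up0 mulr0 addr0.
by rewrite dotmZr -norm2_sqr -/rho expr2 mulKf // gt_eqF.
Qed.

Let pair_vE (th : R) : pair_v G d th = rotated u p th.
Proof. by []. Qed.

Let K := Gt + M.

Lemma pair_path_spectrahedron (th : R) : spectrahedron (pair_path X G d th).
Proof.
rewrite /pair_path (negPf res0) -/u pair_vE; apply: spectrahedron_pair => //.
  by case: u_max.
exact: rotated1.
Qed.

(** At 0 the path has slope - 2 gam rho. The curvature of the rotation costs at
    most [Gt] and smoothness at most [M], because gam <= 1. *)
Lemma pair_path_le (th : R) : 0 <= th <= 1 -> K * th <= rho / 2 ->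
  f (pair_path X G d th) <= f X - th * (gam * rho).
Proof.
move=> /andP[th0 th1] Kth; have th2 := one_plus_sqr_gt0 th.
have thne : 1 + th ^+ 2 != 0 by rewrite gt_eqF.
apply: le_trans (descent_shifted (pair_path_spectrahedron th)) _.
rewrite /pair_path (negPf res0) -/u pair_vE -/gam.
set W := _ - u *m u^T.
have -> : X + gam *: W - X = gam *: W by rewrite addrAC subrr add0r.
rewrite innerZr (uin_scale Nuin) ger0_norm ?(ltW gam0) // -addrA lerD2l.
have NW : beta * N W ^+ 2 <= 2 * (th ^+ 2 / (1 + th ^+ 2)) * M.
  have frac0 : 0 <= th ^+ 2 / (1 + th ^+ 2) by rewrite divr_ge0 ?sqr_ge0 // ltW.
  have [bn|bp] := leP 0 beta; last first.
    apply: (@le_trans _ _ 0); first by rewrite nmulr_rle0 // sqr_ge0.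
    by apply: mulr_ge0 => //; apply: mulr_ge0.
  have NW := uin_rotated_le u1 p1 up0 Nuin th0; rewrite -/W in NW.
  apply: (@le_trans _ _ (beta * ((th ^+ 2 + th) / (1 + th ^+ 2) * diameter N) ^+ 2)).
    apply: ler_wpM2l => //; rewrite ler_pXn2r ?nnegrE ?(uin_ge0 Nuin) //.
    apply: le_trans NW; exact: (uin_ge0 Nuin).
  rewrite [leLHS](_ : _ = ((th + 1) ^+ 2 / (1 + th ^+ 2)) *
    (th ^+ 2 / (1 + th ^+ 2)) * M); last by rewrite /M; field.
  apply: ler_wpM2r => //; apply: ler_wpM2r => //.
  rewrite ler_pdivrMr //; have := sqr_ge0 (th - 1); lra.
have WE := @inner_rotated _ _ u p Gs th (proj1 Gpsd).
rewrite -/W pGu in WE; rewrite WE.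
have gG : qform Gs p - qform Gs u <= Gt.
  have := Gt_qform p1; have := proj2 Gpsd u; lra.
have h1 : beta / 2 * (gam * N W) ^+ 2 <= gam * (th ^+ 2 / (1 + th ^+ 2) * M).
  rewrite [leLHS](_ : _ = gam * (gam * (beta * N W ^+ 2 / 2))); last by ring.
  rewrite ler_pM2l //; apply: (@le_trans _ _ (gam * (th ^+ 2 / (1 + th ^+ 2) * M))).
    by rewrite ler_pM2l //; lra.
  by rewrite ler_piMl // mulr_ge0 // divr_ge0 ?sqr_ge0 // ltW.
apply: le_trans (lerD (lexx _) h1) _.
rewrite -mulrDr [leRHS](_ : _ = gam * (- (th * rho))); last by ring.
rewrite ler_pM2l //.
have h2 : th ^+ 2 * (qform Gs p - qform Gs u) <= th ^+ 2 * Gt.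
  by apply: ler_wpM2l => //; exact: sqr_ge0.
rewrite [X in _ + X]mulrAC -mulrDl ler_pdivrMr //.
have h3 : th * (K * th) <= th * (rho / 2) by rewrite ler_wpM2l.
have thhalf : th <= 1 / 2.
  have Kr : rho <= K by rewrite /K; apply: le_trans rho_le _; rewrite lerDl.
  have K0 : 0 < K by apply: lt_le_trans Kr.
  rewrite -(ler_pM2l K0); lra.
have h4 : th * th <= 1 / 2 * (1 / 2) by apply: ler_pM.
have h5 : 0 <= th * rho by rewrite mulr_ge0.
have h6 : th * rho * (th * th) <= th * rho * (1 / 2 * (1 / 2)) by rewrite ler_wpM2l.
rewrite /K in h3; lra.
Qed.

End Nondegenerate.

Lemma pair_path0 : pair_path X G d 0 = X.
Proof.
rewrite /pair_path; case: ifP => // _.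
rewrite /pair_v scale0r subr0 expr0n addr0 sqrtr1 invr1 scale1r subrr.
by rewrite scaler0 addr0.
Qed.

Lemma pair_rank : (\rank (pair_point f X G d) <= (\rank X).+1)%N.
Proof.
rewrite /pair_point /pair_path; case: ifP => // _.
by apply: rank_pair => //; case: u_max.
Qed.

Lemma pair_progress : let Y := pair_point f X G d in
  [/\ spectrahedron Y, f Y <= f X &
      coef_c X G d <= 4 * (Gt + M) * (f X - f Y)].
Proof.
move=> Y; pose th := armijo f X (pair_path X G d) (pair_delta X G d).
have [thS thf thmax] := armijo_max f (pair_delta X G d) pair_path0.
have YE : Y = pair_path X G d th by [].
rewrite -/th -YE in thS thf; have th01 := step_sizes_bounds thS.
have /andP[th0 th1] := th01.
have K0 : 0 <= Gt + M by rewrite addr_ge0 // Gt_ge0.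
rewrite coef_cE.
have [r0|rn] := eqVneq res 0.
  have -> : Y = X by rewrite YE /pair_path -/res r0 eqxx.
  rewrite subrr mulr0 /rho r0 norm2E dotm0l sqrtr0 expr0n mulr0; split => //.
have pd : pair_delta X G d = gam * rho by rewrite /pair_delta (negPf rn).
rewrite pd in thf.
have := @armijo_large _ _ f X (pair_path X G d) (pair_delta X G d) (Gt + M) (rho / 2) pair_path0.
rewrite -/th pd /= => H.
have {}H : rho / 4 <= (Gt + M) * th.
  have [| |e1|[_ h]] := H.
  - by rewrite divr_ge0.
  - by move=> t t0 t1 Kt; apply: pair_path_le; rewrite ?(ltW t0).
  - rewrite e1 mulr1; apply: (@le_trans _ _ Gt); last by rewrite lerDl.
    by apply: le_trans rho_le; rewrite ler_pdivrMr // ler_peMr //; lra.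
  - lra.
have gr0 : 0 <= gam * rho by rewrite mulr_ge0 // ltW.
split.
- by rewrite YE; exact: pair_path_spectrahedron.
- by apply: le_trans thf _; rewrite gerBl mulr_ge0.
have h1 : gam * rho * (rho / 4) <= gam * rho * ((Gt + M) * th) by rewrite ler_wpM2l.
have : (Gt + M) * (th * (gam * rho)) <= (Gt + M) * (f X - f Y).
  by rewrite ler_wpM2l //; lra.
lra.
Qed.


(** * The next iterate *)

Variable Y : 'M[R]_n.
Hypothesis Ynext : is_next f X G d Y.

Lemma drop_step : is_drop f X G d ->
  [/\ spectrahedron Y, f Y <= f X & (\rank Y < \rank X)%N].
Proof.
move=> dr; move: Ynext; rewrite /is_next dr => ->.
by have [aS af _ _] := away_armijo; split => //; exact: away_drop_rank.
Qed.

Lemma nondrop_step : ~~ is_drop f X G d ->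
  [/\ spectrahedron Y, f Y <= f X & (\rank Y <= (\rank X).+1)%N].
Proof.
move=> dr; move: Ynext; rewrite /is_next (negPf dr) => -[Yin Ymin].
have [aS _ _ _] := away_armijo; have [fS fY _] := fw_progress.
have [pS _ _] := pair_progress.
have YS : spectrahedron Y by case: Yin => [[->|->]|->].
split => //; first by apply: le_trans fY; apply: Ymin; left; left.
case: Yin => [[->|->]|->]; first exact: rank_fw.
  by apply: leq_trans away_rank _.
exact: pair_rank.
Qed.

Lemma nondrop_gap : ~~ is_drop f X G d ->
  (f Y <= f X - g / 2 /\ f Y <= f X - g + M / 2) \/
  (g <= M /\ g ^+ 2 <= 4 * M * (f X - f Y)).
Proof.
move=> dr; move: Ynext; rewrite /is_next (negPf dr) => -[_ Ymin].
have fY : f Y <= f (fw_point f X G d) by apply: Ymin; left; left.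
have [_ _ [[h1 h2]|[h1 h2]]] := fw_progress.
  by left; split; apply: le_trans fY _.
right; split => //; apply: le_trans h2 _; apply: ler_wpM2l; first exact: mulr_ge0.
by rewrite lerD2l lerN2.
Qed.

(** Up to the scale of its path, each coefficient is a squared slope, and the next
    iterate is the best of the three points. A full Frank-Wolfe step gains only
    g / 2, which suffices because g <= Gtilde. *)
Lemma nondrop_coefs : ~~ is_drop f X G d ->
  let e := 8 * (M / 2 + Gt) * (f X - f Y) in
  [/\ coef_a X G <= e, coef_b X G d <= e & coef_c X G d <= e].
Proof.
move=> dr e; have [_ fYX _] := nondrop_step dr.
have D0 : 0 <= f X - f Y by rewrite subr_ge0.
have Gt0 := Gt_ge0; have g0 := gap_ge0.
have MD : 0 <= M * (f X - f Y) by exact: mulr_ge0.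
have GD : 0 <= Gt * (f X - f Y) by exact: mulr_ge0.
have eE : e = 4 * M * (f X - f Y) + 8 * (Gt * (f X - f Y)) by rewrite /e; field.
move: Ynext; rewrite /is_next (negPf dr) => -[_ Ymin].
have fa : f Y <= f (away_point f X G d) by apply: Ymin; left; right.
have fp : f Y <= f (pair_point f X G d) by apply: Ymin; right.
split.
- rewrite /coef_a -/Gs -/g eE; have [[h _]|[_ h]] := nondrop_gap dr; last by lra.
  have gG : g <= Gt by apply: le_trans gap_le_away (Gt_qform vm1).
  have h1 : g * g <= Gt * g by rewrite ler_wpM2r.
  have h2 : Gt * (g / 2) <= Gt * (f X - f Y) by rewrite ler_wpM2l //; lra.
  by rewrite expr2; lra.
- rewrite /coef_b -/Gs -/g -/vm -/b eE.
  have h := away_progress dr.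
  have : M * (f X - f (away_point f X G d)) <= M * (f X - f Y).
    by rewrite ler_wpM2l //; lra.
  lra.
- have [_ _ h] := pair_progress; rewrite eE.
  have h1 : M * (f X - f (pair_point f X G d)) <= M * (f X - f Y).
    by rewrite ler_wpM2l //; lra.
  have h2 : Gt * (f X - f (pair_point f X G d)) <= Gt * (f X - f Y).
    by rewrite ler_wpM2l //; lra.
  lra.
Qed.


(** * Contraction *)

Lemma away_form_le (e : R) (w : 'cV[R]_n) : 0 <= e ->
  coef_a X G <= e ^+ 2 -> coef_b X G d <= e ^+ 2 ->
  qform Gs (X *m w) <= 2 * e * dotm (X *m w) (X *m w).
Proof.
rewrite /coef_a /coef_b -/Gs -/g -/vm -/b => e0 ga ba.
apply: le_trans (away_dir_max w) _; apply: ler_wpM2r; first exact: dotm_ge0.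
have ge : g <= e by rewrite -(ler_pXn2r (n := 2)) ?nnegrE ?gap_ge0.
have be : b <= e by rewrite -(ler_pXn2r (n := 2)) ?nnegrE.
have : qform Gs vm = b + g by rewrite /b subrK.
lra.
Qed.

(** Maximality of the pairwise direction; both forms are homogeneous, so it
    extends from unit vectors to the whole range. *)
Lemma pair_dir_max (w : 'cV[R]_n) :
  dotm (Gs *m (X *m w)) (Gs *m (X *m w)) <=
  gam * dotm (Gs *m u) (Gs *m u) * qform X w.
Proof.
have GG (z : 'cV[R]_n) : qform (Gs *m Gs) z = dotm (Gs *m z) (Gs *m z).
  by rewrite qformE -mulmxA dotm_mull (proj1 Gpsd).
set v := X *m w; have [v0|vn] := eqVneq v 0.
  rewrite v0 mulmx0 dotm0l; apply: mulr_ge0; last by apply: (proj2 (proj1 XS)).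
  by apply: mulr_ge0; [exact: ltW | exact: dotm_ge0].
have [c c0 cv1] := unit_multiple vn; have c2 : 0 < c ^+ 2 by rewrite exprn_gt0.
have iv : unit_image X (c *: v).
  split; last exact: norm2_dot1.
  by rewrite linearZ /= scalemx_sub // /v trmx_mul submxMl.
have [_ /(_ _ iv)] := u_max.
have q0 : 0 < qform (mp_inverse X) (c *: v) by apply: lt_le_trans (mp_ge1 XS iv).
rewrite ler_pdivrMr // !qform_scale !GG -/qu -/gam qform_mp //.
rewrite [leRHS](_ : _ = c ^+ 2 * (gam * dotm (Gs *m u) (Gs *m u) * qform X w)).
  by rewrite ler_pM2l.
by rewrite /gam /pair_weight -/u -/qu; ring.
Qed.

Lemma pair_form_le (e : R) (w : 'cV[R]_n) : 0 <= e ->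
  coef_a X G <= e ^+ 2 -> coef_b X G d <= e ^+ 2 -> coef_c X G d <= e ^+ 2 ->
  dotm (Gs *m (X *m w)) (Gs *m (X *m w)) <= 5 * e ^+ 2 * qform X w.
Proof.
move=> e0 ga ba ca; apply: le_trans (pair_dir_max w) _.
apply: ler_wpM2r; first by apply: (proj2 (proj1 XS)).
have [im_u _] := u_max; have [_ [z uz]] := unit_imageP Xs im_u.
have uu := away_form_le z e0 ga ba; rewrite -uz u1 mulr1 in uu.
have u0 : 0 <= qform Gs u by apply: (proj2 Gpsd).
have uu2 : qform Gs u ^+ 2 <= (2 * e) ^+ 2.
  by rewrite ler_pXn2r ?nnegrE // (le_trans u0).
move: ca; rewrite coef_cE rho_sqr mulrBr.
have : gam * qform Gs u ^+ 2 <= 1 * (2 * e) ^+ 2.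
  by apply: ler_pM => //; [exact: ltW | exact: sqr_ge0].
lra.
Qed.

Lemma nondrop_contraction (alpha : R) (r : nat) :
  0 < alpha -> quadratic_growth N f alpha -> (1 <= r <= n)%N ->
  (forall Z : 'M[R]_n, optimizers f Z -> \rank Z = r) ->
  ~~ is_drop f X G d ->
  ((Num.sqrt 2 - 1) * alpha * min_opt_eigval f r /
    (2560 * r%:R * kappa N r ^+ 2 * (M / 2 + Gt))) * (f X - optval f) <= f X - f Y.
Proof.
move=> alpha0 qg /andP[r0 rn] rkZ dr; set K := M / 2 + Gt; set lam := min_opt_eigval f r.
set h := f X - optval f.
have [_ fYX _] := nondrop_step dr; set D := f X - f Y.
have D0 : 0 <= D by rewrite subr_ge0.
have h0 : 0 <= h by rewrite subr_ge0; exact: (optval_le f_convex f_grad XS).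
have K0 : 0 <= K by rewrite addr_ge0 ?divr_ge0 // Gt_ge0.
have c1152 : 1152 <= 2560 :> R by rewrite ler_nat.
set c : R := 2560 in c1152 *; have c0 : 0 <= c by exact: le_trans (ler0n R 1152) c1152.
clearbody c.
have den0 : 0 <= c * r%:R * kappa N r ^+ 2 * K.
  by apply: mulr_ge0 => //; apply: mulr_ge0; [exact: mulr_ge0 | exact: sqr_ge0].
have t1 : 1 <= Num.sqrt 2 :> R by rewrite -[leLHS]sqrtr1; apply: ler_wsqrtr; rewrite ler1n.
set t : R := Num.sqrt 2 - 1; have t0 : 0 <= t by rewrite subr_ge0.
have [lam0|lam0] := leP lam 0.
  apply: le_trans D0; rewrite mulr_le0_ge0 // mulr_le0_ge0 ?invr_ge0 //.
  by rewrite mulr_ge0_le0 // mulr_ge0 // ltW.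
have [hz|hn] := eqVneq h 0; first by rewrite hz mulr0.
have hp : 0 < h by rewrite lt_neqAle eq_sym hn.
(* Without optimizers, lam would be the infimum of the empty set, which is 0. *)
have [Z0 Zopt0] : exists Z, optimizers f Z.
  apply: contrapT => nopt; move: lam0; rewrite /lam /min_opt_eigval.
  rewrite (_ : [set _ | _ in _] = set0) ?inf0 ?ltxx //.
  by apply/seteqP; split => // x [Z Zo _]; case: nopt; exists Z.
(* The infimum of the growth condition is approached up to a factor two. *)
have [Z Zopt NZ] : exists2 Z, optimizers f Z & N (X - Z) ^+ 2 < 4 / alpha * h.
  have := qg X XS; rewrite -/h => hi.
  have : inf [set N (X - Y0) ^+ 2 | Y0 in optimizers f] < 4 / alpha * h.
    apply: le_lt_trans hi _; rewrite ltr_pM2r // ltr_pM2r ?invr_gt0 //; lra.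
  move=> /inf_lt[|_ [Z Zo <-] Zh]; last by exists Z.
  by exists (N (X - Z0) ^+ 2), Z0.
have [ZS Zmin] := Zopt.
have fZ : f Z = optval f.
  apply/eqP; rewrite eq_le (optval_le f_convex f_grad ZS) andbT.
  apply: lb_le_inf; first by exists (f Z), Z.
  by move=> _ [W WS <-]; exact: Zmin.
have lamZ : lam <= eigval r Z.
  apply: ge_inf; last by exists Z.
  exists 0 => _ [W [[Wp _] _] <-]; apply: eigval_ge0 => //.
  by rewrite r0.
have [|V [m [VZ VXV Vlow]]] := adapted_factor Xs (proj1 ZS) (rkZ _ Zopt).
  by rewrite r0.
pose e := Num.sqrt (8 * K * D).
have e2 : e ^+ 2 = 8 * K * D by rewrite sqr_sqrtr // mulr_ge0 // mulr_ge0.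
have e0 : 0 <= e by exact: sqrtr_ge0.
have [ca cb cc] := nondrop_coefs dr; rewrite -/M -/K -/D -e2 in ca cb cc.
have V1 : dotm V V = 1 by rewrite dotm_outer VZ; case: ZS.
have Vlam z : lam * dotm z z <= qform (V^T *m V) z.
  by apply: le_trans (Vlow z); rewrite ler_wpM2r // dotm_ge0.
have gapZ : h <= inner Gs (X - Z).
  by rewrite /h -fZ; exact: (duality_gap f_convex f_grad XS ZS).
have := @inner_gap _ _ _ N Nuin X Gs V m e lam XS Gpsd e0 lam0.
rewrite VZ => /(_ (fun w => away_form_le w e0 ca cb)
  (fun w => pair_form_le w e0 ca cb cc) V1 VXV Vlam r0 (le_trans h0 gapZ)) main.
rewrite e2 in main.
by apply: rate_of_gap c1152 _ _ _ _ _ _ _ _ gapZ (ltW NZ) main => //; [exact: ltW | exact: sqr_ge0].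
Qed.

End Step.

(** * Convergence *)

(** At the first step, both alternatives bring the gap to at most 3 M / 4. Later, a
    full step halves the gap, and a shortened one replaces it by at most
    h - h^2 / (4 M), which is increasing in [h] on the relevant range. *)
Lemma sublinear_step (R : realType) (M h h' g : R) (k : nat) :
  0 <= M -> 0 <= h -> h <= g -> h' <= h ->
  (h' <= h - g / 2 /\ h' <= h - g + M / 2) \/
  (g <= M /\ g ^+ 2 <= 4 * M * (h - h')) ->
  ((0 < k)%N -> h <= 4 * M / (k + 4)%:R) -> h' <= 4 * M / (k.+1 + 4)%:R.
Proof.
move=> M0 h0 hg hh alt hk; rewrite natrD -[k.+1%:R]natr1.
have kR : 0 <= k%:R :> R by [].
have [k0|k0] := posnP k.
  rewrite k0 add0r (_ : 4 * M / (1 + 4) = 4 / 5 * M); last by field.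
  case: alt => [[_ alt]|[gM alt]]; first by lra.
  have [Mz|Mn] := eqVneq M 0; first by rewrite Mz in gM *; lra.
  have Mp : 0 < M by rewrite lt_neqAle eq_sym Mn.
  have : h ^+ 2 <= g ^+ 2 by rewrite ler_pXn2r ?nnegrE // (le_trans h0).
  have : M * h' <= M * (4 / 5 * M) -> h' <= 4 / 5 * M by rewrite ler_pM2l.
  have := sqr_ge0 (M - h); nra.
have {}hk := hk k0; rewrite natrD in hk.
have n0 : 0 < k%:R + 4 :> R by lra.
set n : R := k%:R + 4 in hk n0 *; have n4 : 4 <= n by rewrite lerDr.
have -> : k%:R + 1 + 4 = n + 1 by rewrite /n; ring.
rewrite ler_pdivlMr // in hk; rewrite ler_pdivlMr; last by lra.
case: alt => [[alt _]|[gM alt]].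
  have : h' * (n + 1) <= h / 2 * (n + 1) by rewrite ler_wpM2r; lra.
  nra.
have [Mz|Mn] := eqVneq M 0.
  have : h' * (n + 1) <= h * (n + 1) by rewrite ler_wpM2r; lra.
  rewrite Mz in hk gM *; nra.
have Mp : 0 < M by rewrite lt_neqAle eq_sym Mn.
have h2 : h ^+ 2 <= g ^+ 2 by rewrite ler_pXn2r ?nnegrE // (le_trans h0).
have s1 : 4 * M * h' <= 4 * M * h - h ^+ 2 by lra.
(* The two sides differ by the product of 4 M - h n and 4 M (n - 1) - h n. *)
have s2 : (4 * M * h - h ^+ 2) * n ^+ 2 <= 16 * M ^+ 2 * (n - 1).
  have : 0 <= (4 * M - h * n) * (4 * M * n - 4 * M - h * n).
    by apply: mulr_ge0; nra.
  nra.
have s3 : 4 * M * h' * n ^+ 2 <= 16 * M ^+ 2 * (n - 1).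
  by apply: le_trans s2; rewrite ler_wpM2r ?sqr_ge0.
have s4 : 4 * M * (h' * n ^+ 2) <= 4 * M * (4 * M * (n - 1)) by lra.
rewrite ler_pM2l in s4; last by lra.
have s5 : h' * n ^+ 2 * (n + 1) <= 4 * M * n ^+ 2.
  have : h' * n ^+ 2 * (n + 1) <= 4 * M * (n - 1) * (n + 1).
    by rewrite ler_wpM2r //; lra.
  nra.
rewrite -(@ler_pM2r _ (n ^+ 2)) ?exprn_gt0 //; lra.
Qed.

Section Run.
Variables (R : realType) (n : nat) (N f : 'M[R]_n -> R).
Variables (grad : 'M[R]_n -> 'M[R]_n) (beta : R).
Variables (stop : option nat) (X : nat -> 'M[R]_n) (d : nat -> directions R n).
Hypothesis Nuin : unitarily_invariant_norm N.
Hypothesis f_convex : convex_function (@spectrahedron R n) f.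
Hypothesis f_grad :
  forall Y : 'M[R]_n, spectrahedron Y -> is_gradient f Y (grad Y).
Hypothesis f_smooth : smooth N beta grad.
Hypothesis run : algorithm_run f grad stop X d.

Let h t := f (X t) - optval f.

Lemma reachedW t : reached stop t.+1 -> reached stop t.
Proof. by rewrite /reached; case: stop => // t0; exact: ltnW. Qed.

Lemma reached1 t : (1 <= t)%N -> reached stop t -> reached stop 1.
Proof. by rewrite /reached; case: stop => // t0; exact: leq_trans. Qed.

(** The rank starts at one, grows by at most one at a non-drop iteration and
    shrinks at a drop iteration; so at least half of the iterations are non-drop.
    The predicate [P] is a rate indexed by their number. *)
Lemma run_count (P : nat -> R -> Prop) :
  P 0%N (h 1) ->
  (forall t k, (1 <= t)%N -> reached stop t.+1 -> spectrahedron (X t) ->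
     ~~ is_drop f (X t) (grad (X t)) (d t) -> P k (h t) -> P k.+1 (h t.+1)) ->
  (forall k x y, y <= x -> P k x -> P k y) ->
  forall t, (1 <= t)%N -> reached stop t ->
  spectrahedron (X t) /\ exists2 k, (uphalf (t - 1) <= k)%N & P k (h t).
Proof.
move=> P1 Pstep Pdec t t1 rt.
suff [XS [k rk Pk]] : spectrahedron (X t) /\
    exists2 k, (\rank (X t) + t <= k.*2 + 2)%N & P k (h t).
  split => //; exists k => //; rewrite leq_uphalf_double leq_subLR.
  by have := rank_spectrahedron XS; move: rk; lia.
elim: t t1 rt => // t IH _ rt; case: t => [|t] in IH rt *.
  have [x x1 ->] := run_init run; split.
    exact: spectrahedron_outer (norm2_eq1 x1).
  exists 0%N => //; rewrite double0 add0n addn1 ltnS.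
  by apply: leq_trans (mxrankM_maxr _ _) (rank_leq_row _).
have [//|//|XS [k rk Pk]] := IH; first exact: reachedW.
have vd : valid_directions (X t.+1) (grad (X t.+1)) (d t.+1).
  by apply: (run_directions run) => //; exact: reachedW.
have [_ nx] : ~ stops _ _ _ /\ is_next _ _ _ _ _ := run_next run (ltn0Sn t) rt.
have [dr|ndr] := boolP (is_drop f (X t.+1) (grad (X t.+1)) (d t.+1)).
  have [YS fY rY] := drop_step XS vd nx dr.
  split => //; exists k; first by move: rk rY; lia.
  by apply: Pdec Pk; rewrite lerD2r.
have [YS fY rY] := nondrop_step Nuin f_convex f_grad f_smooth XS vd nx ndr.
split => //; exists k.+1; first by move: rk rY; lia.
exact: Pstep.
Qed.

Lemma run_spectrahedron t : (1 <= t)%N -> reached stop t -> spectrahedron (X t).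
Proof. by move=> t1 rt; have [] := @run_count (fun _ _ => True) I _ _ t t1 rt. Qed.

End Run.

Lemma min_opt_eigval_ge0 (R : realType) (n r : nat) (f : 'M[R]_n -> R) :
  (1 <= r <= n)%N -> 0 <= min_opt_eigval f r.
Proof.
move=> rn; have [[Z Zo]|nopt] := pselect (exists Z, optimizers f Z).
  apply: lb_le_inf; first by exists (eigval r Z), Z.
  by move=> _ [W [[Wp _] _] <-]; exact: eigval_ge0.
rewrite /min_opt_eigval (_ : [set _ | _ in _] = set0) ?inf0 //.
by apply/seteqP; split => // x [Z Zo _]; case: nopt; exists Z.
Qed.
Theorem theorem1 (R : realType) (n : nat) (N f : 'M[R]_n -> R)
    (grad : 'M[R]_n -> 'M[R]_n) (beta : R)
    (stop : option nat) (X : nat -> 'M[R]_n) (d : nat -> directions R n) :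
  unitarily_invariant_norm N ->
  convex_function (@spectrahedron R n) f ->
  (forall Y : 'M[R]_n, spectrahedron Y -> is_gradient f Y (grad Y)) ->
  smooth N beta grad ->
  algorithm_run f grad stop X d ->
  let h := fun t : nat => f (X t) - optval f in
  let D := diameter N in
  (forall t : nat, (2 <= t)%N -> reached stop t ->
     h t <= 8 * beta * D ^+ 2 / (t + 7)%:R) /\
  (forall (alpha : R) (r : nat),
     0 < alpha -> quadratic_growth N f alpha ->
     (1 <= r <= n)%N -> (forall Y : 'M[R]_n, optimizers f Y -> \rank Y = r) ->
     let rho := Num.min 2^-1
       ((Num.sqrt 2 - 1) * alpha * min_opt_eigval f r /
        (2560 * r%:R * kappa N r ^+ 2 * (beta * D ^+ 2 / 2 + Gtilde grad))) in
     (forall t : nat, (1 <= t)%N -> reached stop t.+1 ->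
        ~~ is_drop f (X t) (grad (X t)) (d t) ->
        h t.+1 <= (1 - rho) * h t) /\
     (forall t : nat, (1 <= t)%N -> reached stop t ->
        h t <= h 1%N * (1 - rho) ^+ uphalf (t - 1))).
Proof.
move=> Nuin fc fg fs run h D; set M := beta * D ^+ 2.
have XS := run_spectrahedron Nuin fc fg fs run.
have h0 t : (1 <= t)%N -> reached stop t -> 0 <= h t.
  by move=> t1 rt; rewrite subr_ge0; apply: (optval_le fc fg); exact: XS.
have vd t : (1 <= t)%N -> reached stop t.+1 ->
    valid_directions (X t) (grad (X t)) (d t).
  by move=> t1 rt; apply: (run_directions run) => //; exact: reachedW.
have nx t : (1 <= t)%N -> reached stop t.+1 ->
    is_next f (X t) (grad (X t)) (d t) (X t.+1).
  by move=> t1 rt; have [] := run_next run t1 rt.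
split.
  move=> t t2 rt; have t1 : (1 <= t)%N by apply: leq_trans t2.
  pose P (k : nat) (x : R) := (0 < k)%N -> x <= 4 * M / (k + 4)%:R.
  have [//|s k s1 rs SS ndr Pk _|k x y yx Pk k0|St [k kt Pk]] :=
    @run_count R n N f grad beta stop X d Nuin fc fg fs run P _ _ _ t t1 rt.
  - have M0 : 0 <= M := smooth_diameter_ge0 Nuin fg fs SS.
    have [_ fY _] := nondrop_step Nuin fc fg fs SS (vd _ s1 rs) (nx _ s1 rs) ndr.
    have gap := nondrop_gap Nuin fc fg fs SS (vd _ s1 rs) (nx _ s1 rs) ndr.
    apply: (@sublinear_step R M (h s) _ (inner (shifted_grad (grad (X s))) (X s))).
    + exact: M0.
    + by apply: h0 => //; exact: reachedW rs.
    + by rewrite /h; have := optval_ge fc fg SS; lra.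
    + by rewrite lerD2r.
    + by case: gap => [[g1 g2]|[g1 g2]]; [left | right]; rewrite /h /M /D; split; lra.
    + exact: Pk.
  - exact: le_trans yx (Pk k0).
  have M0 : 0 <= M := smooth_diameter_ge0 Nuin fg fs St.
  have k0 : (0 < k)%N by move: kt; rewrite leq_uphalf_double; lia.
  apply: le_trans (Pk k0) _.
  have tk : (t + 7)%:R <= 2 * (k + 4)%:R :> R.
    by rewrite -natrM ler_nat; move: kt; rewrite leq_uphalf_double; lia.
  have kp : 0 < (k + 4)%:R :> R by rewrite ltr0n addnS.
  have tp : 0 < (t + 7)%:R :> R by rewrite ltr0n addnS.
  rewrite ler_pdivlMr // mulrAC ler_pdivrMr //.
  have := ler_wpM2l M0 tk; rewrite /M; lra.
move=> alpha r alpha0 qg rn rkZ; set q : R := _ / _; move=> rho.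
have contr t : (1 <= t)%N -> reached stop t.+1 ->
    ~~ is_drop f (X t) (grad (X t)) (d t) -> h t.+1 <= (1 - rho) * h t.
  move=> t1 rs ndr; have rt := reachedW rs; have St := XS _ t1 rt.
  have c := nondrop_contraction Nuin fc fg fs St (vd _ t1 rs) (nx _ t1 rs)
    alpha0 qg rn rkZ ndr; rewrite -/M -/q -/(h t) in c.
  have : rho * h t <= q * h t.
    by rewrite ler_wpM2r ?h0 // /rho ge_min lexx orbT.
  move: c; rewrite /h; lra.
split=> // t t1 rt; have S1 := XS 1%N isT.
have r1 : reached stop 1 by exact: reached1 rt.
have {}S1 := S1 r1.
have M0 : 0 <= M := smooth_diameter_ge0 Nuin fg fs S1.
have [x x1 _] := run_init run.
have Gt0 : 0 <= Gtilde grad := Gtilde_ge0 Nuin fg fs S1 x1.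
have rho1 : rho <= 2^-1 by rewrite /rho ge_min lexx.
have rho0 : 0 <= rho.
  rewrite le_min invr_ge0 ler0n /=.
  have t0 : 0 <= Num.sqrt 2 - 1 :> R.
    by rewrite subr_ge0 -[leLHS]sqrtr1; apply: ler_wsqrtr; rewrite ler1n.
  apply: mulr_ge0; first by rewrite mulr_ge0 ?min_opt_eigval_ge0 // mulr_ge0 // ltW.
  rewrite invr_ge0; apply: mulr_ge0; last by apply: addr_ge0 => //; apply: mulr_ge0.
  by apply: mulr_ge0; [apply: mulr_ge0; exact: ler0n | exact: sqr_ge0].
pose P (k : nat) (y : R) := y <= h 1%N * (1 - rho) ^+ k.
have [|s k s1 rs SS ndr Pk|k y z zy Pk|_ [k kt Pk]] :=
    @run_count R n N f grad beta stop X d Nuin fc fg fs run P _ _ _ t t1 rt.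
- by rewrite /P expr0 mulr1.
- rewrite /P exprS mulrCA; apply: le_trans (contr _ s1 rs ndr) _.
  by rewrite ler_wpM2l // subr_ge0; lra.
- exact: le_trans zy Pk.
apply: le_trans Pk _; rewrite ler_wpM2l ?h0 //.
by apply: ler_wiXn2l => //; rewrite ?subr_ge0 ?gerBl //; lra.
Qed.
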